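(* Let $k,t,n$ be positive integers with $1\le t\le k$ and $2k-t\le n$. If $\mathcal{F}\in\mathcal{M}(n,k,t)$, i.e. $\mathcal{F}$ is a $t$-intersecting family of $k$-multisets of $[n]$, then $$|\mathcal{F}|\le AK(n+k-1,k,t).$$
   Context: $[n]=\{1,\dots,n\}$. A multiset $F$ of $[n]$ is a sequence $(m(1,F),\dots,m(n,F))$ of non-negative integers; its cardinality is $|F|=\sum_{i=1}^n m(i,F)$, and $F$ is a $k$-multiset if $|F|=k$. The intersection $F\cap G$ is the multiset with multiplicities $\min\{m(i,F),m(i,G)\}$. A family (set) $\mathcal{F}$ of multisets is $t$-intersecting if $|F_1\cap F_2|\ge t$ for all $F_1,F_2\in\mathcal{F}$. $\mathcal{M}(n,k,t)$ is the set of all $t$-intersecting families of $k$-multisets of $[n]$. For integers $t\le k\le N$ and $i\ge 0$ let $\mathcal{A}_{N,k,t,i}=\{A: A\subseteq[N],\ |A|=k,\ |A\cap[t+2i]|\ge t+i\}$ (a family of ordinary sets), and define $AK(N,k,t)=\max_{i\ge 0}|\mathcal{A}_{N,k,t,i}|$. *)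

(* Defs.v *)
From mathcomp Require Import all_boot.
From mathcomp Require Import finmap multiset.

Set Implicit Arguments.
Unset Strict Implicit.
Unset Printing Implicit Defensive.

Local Open Scope mset_scope.
Local Open Scope nat_scope.

(* The ground set [n] = {1, ..., n} is encoded as 'I_n = {0, ..., n-1}; a
   multiset F : {mset 'I_n} is applied to i to get the multiplicity of i. *)

Definition mcard (n : nat) (F : {mset 'I_n}) : nat := \sum_(i < n) F i.

Definition t_intersecting (n t : nat) (FF : {fset {mset 'I_n}}) : Prop :=
  forall F1 F2 : {mset 'I_n},
    F1 \in FF -> F2 \in FF -> t <= mcard (F1 `&` F2)%mset.

(* FF is an element of M(n, k, t).  There are finitely many k-multisets of
   [n], so restricting to finite sets {fset _} of multisets loses nothing. *)
Definition in_M (n k t : nat) (FF : {fset {mset 'I_n}}) : Prop :=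
  (forall F : {mset 'I_n}, F \in FF -> mcard F = k) /\ t_intersecting t FF.

(* [m] as a subset of [N]; all of [N] when m >= N. *)
Definition initial (N m : nat) : {set 'I_N} := [set j : 'I_N | j < m].

Definition A_fam (N k t i : nat) : {set {set 'I_N}} :=
  [set A : {set 'I_N} |
    (#|A| == k) && (t + i <= #|A :&: initial N (t + 2 * i)|)].

(* The maximum over all i >= 0: A_fam N k t i is empty as soon as i > k, so
   the range i <= k suffices; see leq_AK and AK_attained. *)
Definition AK (N k t : nat) : nat := \max_(i < k.+1) #|A_fam N k t i|.

Lemma A_fam_eq0 (N k t i : nat) : k < t + i -> A_fam N k t i = set0.
Proof.
move=> lt_k; apply/setP=> A; rewrite !inE; apply/negP => /andP[/eqP cA le_tA].
have := leq_trans le_tA (subset_leq_card (subsetIl A _)).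
by rewrite cA leqNgt lt_k.
Qed.

Lemma leq_AK (N k t i : nat) : #|A_fam N k t i| <= AK N k t.
Proof.
have [le_ik | lt_ki] := leqP i k; last first.
  by rewrite A_fam_eq0 ?cards0 // (leq_trans lt_ki) ?leq_addl.
have lt_ik1 : i < k.+1 by [].
exact: (leq_bigmax (F := fun j : 'I_k.+1 => #|A_fam N k t j|)
  (Ordinal lt_ik1)).
Qed.

Lemma AK_attained (N k t : nat) : exists i : nat, AK N k t = #|A_fam N k t i|.
Proof.
have [|i eq_i] :=
  eq_bigmax (fun j : 'I_k.+1 => #|A_fam N k t j|); first by rewrite card_ord.
by exists i.
Qed.

(* Main.v *)
(** Two [k]-multisets meeting in at least [t] and sharing a repeated element have
    supports whose union misses a point of [[n]], because [2k - t <= n].  Moving the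
    surplus copies of that element to the missed point is a shift, and shifting until
    nothing moves shows that only multiplicities below a given threshold matter for
    the intersections.  Lowering the thresholds to 1 yields a family of the same size
    whose supports pairwise share [t] elements.  A [k]-multiset is then coded by its
    support in [[n]] and by the [k - |support|] numbers in [1, k-1] that are not
    partial sums of its multiplicities: this injects the family into a
    [t]-intersecting family of [k]-sets of [[n+k-1]], to which the complete
    intersection theorem of Ahlswede and Khachatrian applies.

    The latter is proved by their generating set method, run on the [k]-sets
    themselves.  In a largest left-compressed family that is determined by the traces
    on [[m+1]], deleting [m+1] from the traces where it is indispensable trades members
    for new ones; counting both shows that this is impossible unless [m+1 = t + 2s]
    with [s (N - 2(k-t+1)) <= (t-1)(k-t+1)].  Descending in [m], the family is
    determined by the traces on [[t+2r]] for the optimal [r].  The same argument for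
    the complements makes it invariant under the permutations of [[t+2r]], and only the
    Frankl family [A_fam N k t r] is left. *)

Require Import Defs.
From mathcomp Require Import all_boot.
From mathcomp Require Import finmap multiset.
From mathcomp Require Import perm zify.

Local Open Scope nat_scope.

Set Implicit Arguments.
Unset Strict Implicit.
Unset Printing Implicit Defensive.

(** * Shifts *)

Section Shift.
Variables (T : finType) (s : T -> T) (b : pred T).

(* Every orbit [{x, s x}] keeps its number of members, which leave the [b] side
   whenever they can. *)
Definition shift (f : {set T}) : {set T} :=
  [set x | if b x then (x \in f) && (s x \in f)
           else (x \in f) || (s x \in f)].

Hypothesis sK : involutive s.
Hypothesis bs : forall x, b x -> ~~ b (s x).
Hypothesis s_fix : forall x, ~~ b x -> ~~ b (s x) -> s x = x.

(** The doubled sum puts a whole orbit [{x, s x}] into each summand, so that a family and its shift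
    are compared term by term, with no choice of orbit representatives. *)
Lemma sum_shift_dbl (w : T -> nat) (f : {set T}) :
  \sum_(x in f) w x + \sum_(x in f) w x
    = \sum_x ((x \in f) * w x + (s x \in f) * w (s x)).
Proof.
have eS : \sum_(x in f) w x = \sum_x (x \in f) * w x.
  by rewrite big_mkcond; apply: eq_bigr => x _; case: ifP; rewrite ?mul1n.
rewrite big_split /= -eS; congr (_ + _).
by rewrite eS (reindex_inj (inv_inj sK)).
Qed.

Lemma card_shift (f : {set T}) : #|shift f| = #|f|.
Proof.
have := sum_shift_dbl (fun=> 1) (shift f); have := sum_shift_dbl (fun=> 1) f.
rewrite !sum1_card => ef es; apply: double_inj; rewrite -!addnn ef es.
apply: eq_bigr => x _; rewrite !inE sK.
have [bx|nbx] := boolP (b x); first by rewrite (negbTE (bs bx)); do 2!case: (_ \in f).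
have [bsx|nbsx] := boolP (b (s x)); first by do 2!case: (_ \in f).
by rewrite s_fix // orbb.
Qed.

Lemma weight_shift (w : T -> nat) (f : {set T}) x0 :
  (forall x, b x -> w (s x) < w x) -> x0 \in f -> b x0 -> s x0 \notin f ->
  \sum_(x in shift f) w x < \sum_(x in f) w x.
Proof.
move=> w_lt x0f bx0 sx0; rewrite -ltn_double -!addnn !sum_shift_dbl.
have le x : (x \in shift f) * w x + (s x \in shift f) * w (s x)
            <= (x \in f) * w x + (s x \in f) * w (s x).
  rewrite !inE sK.
  have [bx|nbx] := boolP (b x).
    rewrite (negbTE (bs bx)); have := w_lt _ bx.
    by do 2!case: (_ \in f); rewrite /=; lia.
  have [bsx|nbsx] := boolP (b (s x)).
    have := w_lt _ bsx; rewrite sK; do 2!case: (_ \in f); rewrite /=; lia.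
  by rewrite s_fix // orbb.
rewrite (bigD1 x0) //= [ltnRHS](bigD1 x0) //= -addSn leq_add ?leq_sum //.
by rewrite !inE sK bx0 (negbTE (bs bx0)) x0f (negbTE sx0) /=; have := w_lt _ bx0; lia.
Qed.

(** A new member [x] of the shift comes from [s x] in [f], on the [b] side. If [y] is new too, or an
    old member on the [b] side, then [s y] also lies in [f], and the hypothesis moving both
    arguments applies. Any other [y] is old and off the [b] side, where moving [x] alone
    suffices. *)
Lemma shift_rel (I : rel T) (f : {set T}) :
  symmetric I ->
  (forall x y, b (s x) -> b y || b (s y) -> I (s x) (s y) -> I x y) ->
  (forall x y, b (s x) -> ~~ b y -> I (s x) y -> I x y) ->
  {in f &, forall x y, I x y} -> {in shift f &, forall x y, I x y}.
Proof.
move=> symI I2 I1 If.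
have new x : x \in shift f -> x \notin f -> (s x \in f) && b (s x).
  rewrite inE; case: ifP => [_ /andP[-> //]|/negbT nbx].
  move=> /orP[-> //|sxf] xf; rewrite sxf /=.
  by apply: contraNT xf => nbsx; rewrite -[x]sK s_fix ?sK.
have newI x y : x \in shift f -> x \notin f -> y \in shift f -> I x y.
  move=> xS xf yS; have /andP[sxf bsx] := new _ xS xf.
  have [yf|yf] := boolP (y \in f); last first.
    by have /andP[syf bsy] := new _ yS yf; apply: I2; rewrite ?bsy ?orbT //; apply: If.
  have [by_|nby] := boolP (b y); last by apply: I1 => //; apply: If.
  apply: I2; rewrite ?by_ //; apply: If => //.
  by move: yS; rewrite inE by_ => /andP[].
move=> x y xS yS; have [xf|xf] := boolP (x \in f); last exact: newI.
have [yf|yf] := boolP (y \in f); first exact: If.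
by rewrite symI newI.
Qed.

End Shift.

(** A shift that changes the family strictly lowers its total weight, so shifting terminates. *)
Lemma shift_stable (T J : finType) (s : J -> T -> T) (b : J -> pred T)
    (w : T -> nat) (P : {set T} -> Prop) (f : {set T}) :
  (forall j, involutive (s j)) ->
  (forall j x, b j x -> ~~ b j (s j x)) ->
  (forall j x, ~~ b j x -> ~~ b j (s j x) -> s j x = x) ->
  (forall j x, b j x -> w (s j x) < w x) ->
  (forall j g, P g -> P (shift (s j) (b j) g)) ->
  P f ->
  exists g : {set T}, [/\ P g, #|g| = #|f| &
    forall j x, x \in g -> b j x -> s j x \in g].
Proof.
move=> sK bs s_fix w_lt PS.
have [m] := ubnP (\sum_(x in f) w x); elim: m f => // m IH f lt_m Pf.
have [/forallP st|] := boolP [forall j, [forall x in f, b j x ==> (s j x \in f)]].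
  by exists f; split=> // j x xf; apply/implyP; move/forall_inP: (st j); apply.
rewrite negb_forall => /existsP[j]; rewrite negb_forall_in => /exists_inP[x xf].
rewrite negb_imply => /andP[bx sx].
have [||g [Pg cg st]] := IH (shift (s j) (b j) f).
- exact: leq_trans (weight_shift (sK j) (bs j) (s_fix j) (w_lt j) xf bx sx) lt_m.
- exact: PS.
exists g; split=> //; rewrite cg; exact: card_shift (sK j) (bs j) (s_fix j) f.
Qed.

(** * The complete intersection theorem *)

Lemma sum_card_rel (T U : finType) (X : {set T}) (P : T -> U -> bool) :
  \sum_(x in X) #|[set u | P x u]| = \sum_u #|[set x in X | P x u]|.
Proof.
under eq_bigr do rewrite -sum1dep_card big_mkcond.
rewrite exchange_big; apply: eq_bigr => u _ /=.
by rewrite -big_mkcondr -sum1dep_card.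
Qed.

Lemma card_initial (N m : nat) : m <= N -> #|initial N m| = m.
Proof.
move=> le_mN; rewrite /initial -sum1dep_card.
by rewrite -(big_ord_widen N (fun=> 1) le_mN) sum1_card card_ord.
Qed.

Lemma card_interval (N a b : nat) : b <= N ->
  #|[set j : 'I_N | a <= j < b]| = b - a.
Proof.
move=> le_bN; have [le_ab|lt_ba] := leqP a b; last first.
  rewrite (_ : [set j | _] = set0) ?cards0; first by lia.
  by apply/setP => j; rewrite !inE; lia.
have -> : [set j : 'I_N | a <= j < b] = initial N b :\: initial N a.
  by apply/setP => j; rewrite !inE -leqNgt.
rewrite cardsD (setIidPr _) ?card_initial //; first exact: leq_trans le_bN.
by apply/subsetP => j; rewrite !inE; lia.
Qed.

(** * Exchanging one point of a set for another *)

Section Swap.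
Variable N : nat.
Implicit Types (A B : {set 'I_N}) (a b c : 'I_N).

Definition swap a b A : {set 'I_N} := [set x | tperm a b x \in A].

Lemma in_swapL a b A : (a \in swap a b A) = (b \in A).
Proof. by rewrite inE tpermL. Qed.

Lemma in_swapR a b A : (b \in swap a b A) = (a \in A).
Proof. by rewrite inE tpermR. Qed.

Lemma in_swapD a b A x : a != x -> b != x -> (x \in swap a b A) = (x \in A).
Proof. by move=> ax bx; rewrite inE tpermD. Qed.

Lemma swapK a b : involutive (swap a b).
Proof. by move=> A; apply/setP => x; rewrite !inE tpermK. Qed.

Lemma swapC a b A : swap a b A = swap b a A.
Proof. by rewrite /swap tpermC. Qed.

Lemma card_swap a b A : #|swap a b A| = #|A|.
Proof. exact: (card_preimset _ (@perm_inj _ (tperm a b))). Qed.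

Lemma swapI a b A B : swap a b A :&: swap a b B = swap a b (A :&: B).
Proof. by apply/setP => x; rewrite !inE. Qed.

Lemma swap_id a b A : (a \in A) = (b \in A) -> swap a b A = A.
Proof. by move=> e; apply/setP => x; rewrite inE; case: tpermP => // ->. Qed.

Lemma swap_setU1 a b A : a \in A -> b \notin A -> swap a b A = b |: (A :\ a).
Proof.
move=> aA bA; apply/setP => x; rewrite !inE; case: tpermP => [->|->|/eqP xa /eqP xb].
- by rewrite (negbTE bA) eqxx orbF; apply/esym/negbTE; apply: contraNneq bA => <-.
- by rewrite aA eqxx.
- by rewrite xa (negbTE xb).
Qed.

Lemma card_swapI a b A B : a \in A -> b \notin A ->
  #|swap a b A :&: B| + (a \in B) = #|A :&: B| + (b \in B).
Proof.
move=> aA bA; rewrite (cardsD1 b) (cardsD1 a (A :&: B)) !in_setI in_swapR aA /=.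
suff -> : (swap a b A :&: B) :\ b = (A :&: B) :\ a.
  by rewrite addnC addnCA [RHS]addnC.
rewrite swap_setU1 //; apply/setP => x; rewrite !inE.
have [->|] := eqVneq x b; first by rewrite (negbTE bA) andbF.
by move=> _; rewrite /= andbA.
Qed.

Lemma swap_swap a b c A : a \in A -> b \notin A -> c \notin A ->
  swap b c (swap a b A) = swap a c A.
Proof.
move=> aA bA cA.
have [<-|bc] := eqVneq b c; first by rewrite swap_id.
have ac : a != c by apply: contraNneq cA => <-.
have ba : b != a by apply: contraNneq bA => ->.
rewrite swap_setU1 ?in_swapR ?in_swapD // !swap_setU1 //.
apply/setP => x; rewrite !inE; have [->|] := eqVneq x b => //=.
by rewrite (negbTE bA) andbF.
Qed.

Lemma swap_swapl a b c A : a \in A -> b \in A -> c \notin A ->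
  swap a b (swap b c A) = swap a c A.
Proof.
move=> aA bA cA.
have [->|ab] := eqVneq a b; first by rewrite swap_id.
have ac : a != c by apply: contraNneq cA => <-.
have bc : b != c by apply: contraNneq cA => <-.
rewrite swap_setU1 ?in_swapL // ?in_swapD // 1?eq_sym // !swap_setU1 //.
apply/setP => x; rewrite !inE; have [->|] := eqVneq x b => //=.
  by rewrite bA [b == a]eq_sym ab orbT.
by move=> _; have [->|] := eqVneq x c; rewrite /= ?andbF ?[c == a]eq_sym ?ac.
Qed.

Lemma swap_disjoint a b c d A : a != c -> a != d -> b != c -> b != d ->
  swap a b (swap c d A) = swap c d (swap a b A).
Proof.
move=> ac ad bc bd; apply/setP => x; rewrite !inE; congr (_ \in A).
have D y : y != c -> y != d -> tperm c d y = y by move=> *; rewrite tpermD // eq_sym.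
have [->|xa] := eqVneq x a; first by rewrite tpermL !D ?tpermL.
have [->|xb] := eqVneq x b; first by rewrite tpermR !D ?tpermR.
rewrite [tperm a b x]tpermD 1?eq_sym //.
by case: tpermP => [_|_|_ _]; rewrite tpermD // eq_sym.
Qed.

Lemma sum_swap a b A : a \in A -> b \notin A ->
  \sum_(x in swap a b A) x + a = \sum_(x in A) x + b.
Proof.
move=> aA bA; rewrite swap_setU1 // big_setU1 ?(big_setD1 a aA) /=.
  by rewrite addnAC [RHS]addnAC (addnC a).
by rewrite !inE (negbTE bA) andbF.
Qed.

End Swap.

(** * Intersecting families and their left-compression *)

Section Families.
Variable N : nat.
Implicit Types (A B F G H : {set 'I_N}) (f g X R : {set {set 'I_N}}).

Definition tfamily k t f :=
  [forall F in f, #|F| == k] && [forall F in f, forall H in f, t <= #|F :&: H|].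

Lemma tfamilyP k t f :
  reflect ((forall F, F \in f -> #|F| = k) /\
           (forall F H, F \in f -> H \in f -> t <= #|F :&: H|))
          (tfamily k t f).
Proof.
apply: (iffP andP) => [[/forall_inP uf /forall_inP tf]|[uf tf]].
  by split=> [F /uf/eqP //|F H Ff]; move/forall_inP: (tf _ Ff); apply.
split; apply/forall_inP => F Ff; first by rewrite uf.
by apply/forall_inP => H; apply: tf.
Qed.

Definition maximal k t f :=
  tfamily k t f /\ forall g, tfamily k t g -> #|g| <= #|f|.

Definition left_compressed f := forall F (i j : 'I_N),
  F \in f -> i < j -> j \in F -> i \notin F -> swap j i F \in f.

(* In the language of generating sets: every member of [f] has a generator contained
   in the first [m] points. *)
Definition generated (m : nat) f := forall F (l q : 'I_N),
  F \in f -> m <= l -> l \in F -> q \notin F -> swap l q F \in f.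

Lemma ex_maximal k t : exists f, maximal k t f.
Proof.
have g0 : tfamily k t set0.
  by apply/tfamilyP; split=> [F|F H]; rewrite inE.
case: (arg_maxnP (fun f : {set {set 'I_N}} => #|f|) g0) => f gf maxf.
by exists f; split=> // g; apply: maxf.
Qed.

Section Compress.
Variables (k t m : nat).

Let J := {p : 'I_N * 'I_N | p.1 < p.2}.
Let s (j : J) := swap (val j).2 (val j).1.
Let b (j : J) F := ((val j).2 \in F) && ((val j).1 \notin F).

Let sK j : involutive (s j). Proof. exact: swapK. Qed.

Let bs j F : b j F -> ~~ b j (s j F).
Proof. by case/andP=> hc ha; rewrite /b /s in_swapL (negbTE ha). Qed.

Let bsE j F : b j (s j F) = ((val j).1 \in F) && ((val j).2 \notin F).
Proof. by rewrite /b /s in_swapL in_swapR. Qed.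

Let s_fix j F : ~~ b j F -> ~~ b j (s j F) -> s j F = F.
Proof.
rewrite bsE /b => h1 h2; apply: swap_id.
by move: h1 h2; do 2!case: (_ \in F).
Qed.

Lemma shift_tfamily j f :
  tfamily k t f -> tfamily k t (shift (s j) (b j) f).
Proof.
move=> /tfamilyP[uf tf]; apply/tfamilyP; split.
  move=> F; rewrite inE; case: ifP => _; first by case/andP=> /uf.
  by case/orP=> /uf //; rewrite card_swap.
apply: (@shift_rel _ _ _ (@sK j) (@s_fix j) (fun F H => t <= #|F :&: H|)) => //.
- by move=> F H; rewrite setIC.
- by move=> F H _ _; rewrite swapI card_swap.
move=> F H; rewrite bsE => /andP[aF cF] nbH; rewrite /s swapC => le_t.
have := card_swapI H aF cF; rewrite -/(s j F).
have : ((val j).2 \in H) <= ((val j).1 \in H).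
  by move: nbH; rewrite /b; do 2!case: (_ \in H).
by lia.
Qed.

(** Let [j] be the pair [a < c]. If [m <= c], then [generated m f] already makes [f] stable under
    replacing [c] by [a], and the shift changes nothing. Otherwise [a < c < m <= l], so [swap l q]
    commutes with [swap c a] unless [q] is [a] or [c]; these coincidences are settled by
    [generated m f] and by composing exchanges. *)
Lemma shift_generated j f :
  generated m f -> generated m (shift (s j) (b j) f).
Proof.
case: j => [[a c] /= lt_ac]; set j := exist _ _ _ => gf.
have [le_mc|lt_cm] := leqP m c.
  suff -> : shift (s j) (b j) f = f by [].
  have st F : F \in f -> b j F -> s j F \in f.
    by move=> Ff /andP[cF aF]; apply: gf.
  apply/setP => F; rewrite inE; case: ifP => [bF|/negbT nbF].
    by have [Ff|//] := boolP (F \in f); rewrite st.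
  have [//|Ff /=] := boolP (F \in f); apply: contraNF Ff => sFf.
  have [bsF|nbsF] := boolP (b j (s j F)); last by rewrite -(s_fix nbF nbsF).
  by rewrite -[F](sK j) st.
move=> F l q Fsf le_ml lF qF.
have lc : l != c by apply: contraTneq le_ml => ->; rewrite -ltnNge.
have la : l != a.
  by apply: contraTneq le_ml => ->; rewrite -ltnNge (ltn_trans lt_ac).
have aDc : a != c by have := lt_ac; apply: contraTneq => ->; rewrite ltnn.
move: Fsf; rewrite !inE; case: ifP => [/andP[/= cF aF] /andP[Ff sFf]|/negbT nbF FsF].
  have qc : q != c by apply: contraNneq qF => ->.
  have [->|qa] := eqVneq q a.
    rewrite /b /= in_swapR lF andbF; apply/orP; left; exact: gf.
  rewrite /b /= !in_swapD // cF aF /= gf //.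
  rewrite /s /= swap_disjoint 1?eq_sym // gf // ?in_swapD // 1?eq_sym //.
case: ifP => [/andP[/=]|/negbT nbF'].
  have qa : q != a -> a \notin swap l q F -> a \notin F by move=> qa; rewrite in_swapD.
  have [->|{}/qa qa] := eqVneq q a; first by rewrite in_swapR lF.
  move=> cF' /qa aF; have cF : c \notin F by move: nbF; rewrite /b /= aF andbT.
  have qc : q = c.
    by apply/eqP; apply: contraTT cF' => qc; rewrite in_swapD.
  have Ff : F \in f.
    have sF : s j F = F by apply: swap_id; rewrite /= (negbTE aF) (negbTE cF).
    by move: FsF; rewrite sF orbb.
  by rewrite qc gf //= /s /= swap_swap // gf.
have [Ff|Ff] := boolP (F \in f); first by rewrite gf.
move: FsF; rewrite (negbTE Ff) /= => sFf; apply/orP; right.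
have bsF : b j (s j F) by apply: contraNT Ff => /(s_fix nbF) <-.
move: bsF; rewrite bsE /= => /andP[aF cF].
have qa : q != a by apply: contraNneq qF => ->.
have [->|qc] := eqVneq q c.
  rewrite /s /= swap_id ?in_swapR ?in_swapD ?lF ?aF // 1?eq_sym //.
  suff -> : swap l c F = swap l a (swap c a F).
    apply: gf => //; last by rewrite in_swapR.
    by rewrite in_swapD // eq_sym.
  by rewrite [swap c a F]swapC swap_swapl.
by rewrite /s /= swap_disjoint 1?eq_sym // gf // ?in_swapD // 1?eq_sym.
Qed.

Lemma ex_compressed f : maximal k t f -> generated m f ->
  exists g, [/\ maximal k t g, generated m g & left_compressed g].
Proof.
move=> [tf maxf] gf.
have [|||g [[tg gg] cg st]] := @shift_stable _ J s b (fun F => \sum_(x in F) x)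
    (fun g => tfamily k t g /\ generated m g) f sK bs s_fix.
- move=> [[a c] /= lt_ac] F /andP[/= cF aF].
  by have := sum_swap cF aF; rewrite /s /=; lia.
- by move=> j g [tg gg]; split; [apply: shift_tfamily | apply: shift_generated].
- by split.
exists g; split=> //; first by split=> // h; rewrite cg; apply: maxf.
move=> F i j Fg lt_ij jF iF.
by apply: (st (exist _ (i, j) lt_ij)); rewrite // /b /= jF.
Qed.

End Compress.

End Families.

(** The averaging inequality [s * (N - mu) <= mu * (k.+1 - (t + s))] and the Ahlswede-Khachatrian
    condition [s * (N - (k.+1 - t).*2) <= t.-1 * (k.+1 - t)] have the same slack. Sums on both sides
    keep truncated differences of products away. *)
Lemma star_bound_identity (N k t s mu : nat) :
  0 < t -> mu.+1 = t + s.*2 -> t + s <= k -> mu < N -> k.*2.+2 <= N + t ->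
  mu * (k.+1 - (t + s)) + s * (N - (k.+1 - t).*2)
    = s * (N - mu) + t.-1 * (k.+1 - t).
Proof.
case: t => // u _ emu le_k lt_mu le_N.
have [e ek] : exists e, k = u + s + e by exists (k - (u + s)); lia.
have [D eD] : exists D, N = (s + e).*2 + D by exists (N - (s + e).*2); lia.
have [Y eY] : exists Y, N = mu + Y by exists (N - mu); lia.
have -> : k.+1 - (u.+1 + s) = e by lia.
have -> : k.+1 - u.+1 = s + e by lia.
have -> : N - (s + e).*2 = D by lia.
have -> : N - mu = Y by lia.
have -> /= : mu = u + s.*2 by lia.
have : s * (u + Y) = s * (e.*2 + D) by congr (_ * _); lia.
by rewrite -!addnn !mulnDr !mulnDl; nia.
Qed.

(** * Replacing the members that depend on the last generating point *)

Section Star.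
Variables (N k t : nat) (mu : 'I_N) (f : {set {set 'I_N}}).
Implicit Types (F G H : {set 'I_N}) (X R : {set {set 'I_N}}).
Hypotheses (maxf : maximal k t f) (lcf : left_compressed f)
  (genf : generated mu.+1 f).

Let uf F : F \in f -> #|F| = k.
Proof. by case: maxf => /tfamilyP[uf _] _; apply: uf. Qed.

Let tf F H : F \in f -> H \in f -> t <= #|F :&: H|.
Proof. by case: maxf => /tfamilyP[_ tf] _; apply: tf. Qed.

(* The members from whose generator [mu] cannot be removed. *)
Definition star : {set {set 'I_N}} :=
  [set F in f | (mu \in F) &&
    [exists q : 'I_N, [&& mu < q, q \notin F & swap mu q F \notin f]]].

Definition rank F := #|F :&: initial N mu.+1|.

(** For sets of a fixed size: membership depends only on the trace on the first [mu.+1] points. *)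
Definition exchangeable X := forall F (l q : 'I_N),
  F \in X -> mu < l -> l \in F -> mu < q -> q \notin F -> swap l q F \in X.

(* The sets generated by the traces of [X] with [mu] removed, and not by these traces
   themselves. *)
Definition push X : {set {set 'I_N}} :=
  [set G : {set _} | (mu \notin G) &&
    [exists l : 'I_N, [&& mu < l, l \in G & swap l mu G \in X]]].

Lemma starS F : F \in star -> F \in f. Proof. by rewrite inE => /andP[]. Qed.

Lemma star_mu F : F \in star -> mu \in F.
Proof. by rewrite inE => /and3P[]. Qed.

(** [genf] exchanges points above [mu] for one another, so if one replacement of [mu] leaves [f],
    then all do. *)
Lemma star_notin F (q : 'I_N) :
  F \in star -> mu < q -> q \notin F -> swap mu q F \notin f.
Proof.
rewrite inE => /and3P[Ff muF /existsP[p /and3P[lt_p pF pf]]] lt_q qF.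
have [<- //|qp] := eqVneq p q; apply: contra pf => qf.
rewrite -(swap_swap muF qF pF) genf ?in_swapR // in_swapD //.
  by apply: contraTneq lt_p => ->; rewrite ltnn.
by rewrite eq_sym.
Qed.

Lemma notin_star F (q : 'I_N) :
  F \in f -> F \notin star -> mu \in F -> mu < q -> q \notin F ->
  swap mu q F \in f.
Proof.
move=> Ff nsF muF lt_q qF; apply: contraNT nsF => qf; rewrite inE Ff muF /=.
by apply/existsP; exists q; rewrite lt_q qF.
Qed.

Let gt_neq (l : 'I_N) : mu < l -> l != mu.
Proof. by apply: contraTneq => ->; rewrite ltnn. Qed.

Lemma exchangeable_star : exchangeable star.
Proof.
move=> F l q Fs lt_l lF lt_q qF; have muF := star_mu Fs.
rewrite inE genf ?starS //= in_swapD ?gt_neq // muF /=.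
apply/existsP; exists l; rewrite lt_l in_swapL qF /=.
by rewrite swap_swapl // star_notin.
Qed.

Lemma rank_exchange F (l q : 'I_N) :
  mu < l -> l \in F -> mu < q -> q \notin F -> rank (swap l q F) = rank F.
Proof.
move=> lt_l lF lt_q qF; have := card_swapI (initial N mu.+1) lF qF.
by rewrite !inE !ltnS ![_ <= mu]leqNgt lt_l lt_q !addn0.
Qed.

Lemma card_above F :
  #|[set l : 'I_N | (mu < l) && (l \in F)]| + rank F = #|F|.
Proof.
rewrite -(cardsID (initial N mu.+1) F) addnC; congr (_ + #|pred_of_set _|).
by apply/setP => l; rewrite !inE ltnS ltnNge.
Qed.

Lemma card_above_notin F :
  #|[set l : 'I_N | (mu < l) && (l \notin F)]| + #|F| + mu.+1 = N + rank F.
Proof.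
have := card_above (~: F); have := cardsC F.
have := cardsID F (initial N mu.+1); rewrite card_initial // card_ord.
rewrite setDE ![initial N _ :&: _]setIC -/(rank F) -/(rank (~: F)).
rewrite (_ : [set l | _ & l \in ~: F] = [set l : 'I_N | (mu < l) && (l \notin F)]).
  by clear; lia.
by apply/setP => l; rewrite !inE.
Qed.

Section Push.
Variables X R : {set {set 'I_N}}.
Hypotheses (XS : X \subset star) (exX : exchangeable X).

Lemma push_all G (l : 'I_N) :
  G \in push X -> mu < l -> l \in G -> swap l mu G \in X.
Proof.
rewrite inE => /andP[muG /existsP[p /and3P[lt_p pG pX]]] lt_l lG.
have [<- //|lp] := eqVneq p l.
rewrite -(swap_swapl lG pG muG) exX // ?in_swapL // in_swapD // eq_sym.
exact: gt_neq.
Qed.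

Lemma push_swap F (l : 'I_N) :
  F \in X -> mu < l -> l \notin F -> swap mu l F \in push X.
Proof.
move=> FX lt_l lF; have muF := star_mu (subsetP XS _ FX).
rewrite inE in_swapL lF /=; apply/existsP; exists l.
by rewrite lt_l in_swapR muF swapC swapK.
Qed.

Lemma pushE G : G \in push X -> exists F (l : 'I_N),
  [/\ F \in X, mu < l, l \notin F & G = swap mu l F].
Proof.
rewrite inE => /andP[muG /existsP[l /and3P[lt_l lG lX]]].
by exists (swap l mu G), l; split; rewrite ?in_swapL // swapC swapK.
Qed.

Lemma push_notin G : G \in push X -> G \notin f.
Proof. by move=> /pushE[F [l [/(subsetP XS) Fs lt_l lF ->]]]; apply: star_notin. Qed.

(** Replacing [mu] by [l] in [F] can hurt only if [F] meets [H] in exactly [t] points, with [mu] in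
    [H] and [l] outside. Then some exchange in [f] would already leave [t - 1] common points: in
    [F], a common point above [mu] for [l]; in [H], [mu] for [l] when [H] is not in [star], and
    otherwise [mu] for the uncovered [p] given by [sep]. *)
Lemma push_tfamily : R \subset star -> [disjoint X & R] ->
  (forall F H, F \in X -> H \in star -> H \notin R ->
    #|F :&: H| = t -> F :&: H \subset initial N mu.+1 ->
    exists p : 'I_N, [/\ p < mu, p \notin F & p \notin H]) ->
  tfamily k t ((f :\: R) :|: push X).
Proof.
move=> RS dXR sep.
have cardP G : G \in push X -> #|G| = k.
  move=> /pushE[F [l [/(subsetP XS)/starS Ff _ _ ->]]].
  by rewrite card_swap uf.
have new_old G H : G \in push X -> H \in f -> H \notin R -> t <= #|G :&: H|.
  move=> /pushE[F [l [FX lt_l lF ->]]] Hf HR.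
  have Fs := subsetP XS _ FX; have Ff := starS Fs; have muF := star_mu Fs.
  have le_t := tf Ff Hf.
  have e := card_swapI H muF lF.
  have [muH|muH] := boolP (mu \in H); last first.
    by rewrite (negbTE muH) in e; clear -e le_t; lia.
  have [lH|lH] := boolP (l \in H); first by rewrite muH lH in e; clear -e le_t; lia.
  rewrite muH (negbTE lH) in e; have [//|lt_t] := leqP t #|swap mu l F :&: H|.
  have cFH : #|F :&: H| = t by clear -e le_t lt_t; lia.
  have sFH : F :&: H \subset initial N mu.+1.
    apply/subsetP => p; rewrite !inE => /andP[pF pH]; rewrite ltnS leqNgt.
    apply/negP => lt_p; have := tf (genf Ff lt_p pF lF) Hf.
    by have := card_swapI H pF lF; rewrite pH (negbTE lH); clear -cFH; lia.
  have [Hs|Hs] := boolP (H \in star).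
    have [p [lt_p pF pH]] := sep _ _ FX Hs HR cFH sFH.
    have := tf (lcf Hf lt_p muH pH) Ff; have := card_swapI F muH pH.
    by rewrite muF (negbTE pF) ![_ :&: F]setIC; clear -cFH; lia.
  have := tf (notin_star Hf Hs muH lt_l lH) Ff; have := card_swapI F muH lH.
  by rewrite muF (negbTE lF) ![_ :&: F]setIC; clear -cFH; lia.
(* [H] no longer contains [mu], so pushing [F] as well loses nothing. *)
have new_new G H : G \in push X -> H \in push X -> t <= #|G :&: H|.
  move=> /pushE[F [l [FX lt_l lF ->]]] HX.
  have Fs := subsetP XS _ FX; have muF := star_mu Fs.
  have muH : mu \notin H by move: HX; rewrite inE => /andP[].
  have FR : F \notin R by rewrite (disjointFr dXR FX).
  have := new_old _ _ HX (starS Fs) FR.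
  by have := card_swapI H muF lF; rewrite (negbTE muH) [H :&: F]setIC; clear; lia.
apply/tfamilyP; split=> [F|F H]; rewrite !in_setU !in_setD.
  by case/orP=> [/andP[_ /uf]|/cardP].
move=> /orP[/andP[FR Ff]|FX] /orP[/andP[HR Hf]|HX];
[exact: tf| |exact: new_old|exact: new_new].
by rewrite setIC new_old.
Qed.

(** A member of [star] is either removed with [R], or lies in [X] and then its replacements of [mu]
    by larger points are all in [push X]; smaller points are reached by compression. Hence [mu]
    becomes as replaceable as the points above it. *)
Lemma push_generated : exchangeable R -> star \subset X :|: R ->
  [disjoint X & R] -> R \subset star -> generated mu ((f :\: R) :|: push X).
Proof.
move=> exR sXR dXR RS.
have muR F : F \in R -> mu \in F by move/(subsetP RS)/star_mu.
have old F : F \in f -> mu \notin F -> F \in (f :\: R) :|: push X.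
  by move=> Ff muF; rewrite in_setU in_setD Ff (contra (@muR F)).
have oldX F : F \in X -> F \in (f :\: R) :|: push X.
  by move=> FX; rewrite in_setU in_setD (disjointFr dXR FX) starS // (subsetP XS).
move=> G l q; rewrite in_setU in_setD => GfX; rewrite leq_eqVlt.
case/predU1P=> [/val_inj <-|lt_l lG qG].
  move=> muG qG; have {GfX} /andP[GR Gf] : (G \notin R) && (G \in f).
    by case/orP: GfX => //; rewrite inE muG.
  have [lt_q|lt_q|/val_inj eq_q] := ltngtP q mu.
  - by apply: old; [apply: lcf | rewrite in_swapL].
  - have [Gs|Gs] := boolP (G \in star); last first.
      by apply: old; [apply: notin_star | rewrite in_swapL].
    rewrite in_setU push_swap ?orbT //.
    by have := subsetP sXR _ Gs; rewrite in_setU (negbTE GR) orbF.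
  - by rewrite eq_q muG in qG.
have lmu := gt_neq lt_l.
case/orP: GfX => [/andP[GR Gf]|GX].
  rewrite in_setU in_setD genf // andbT; apply/orP; left.
  apply: contra GR => sGR; have sGs := subsetP RS _ sGR.
  have qsG : q \in swap l q G by rewrite in_swapR.
  have lsG : l \notin swap l q G by rewrite in_swapL.
  have [lt_q|lt_q|/val_inj eq_q] := ltngtP q mu.
  - have muG : mu \in G.
      have := star_mu sGs; rewrite in_swapD //.
      by apply: contraTneq lt_q => ->; rewrite ltnn.
    have := star_notin sGs lt_l lsG.
    by rewrite swap_swapl // lcf.
  - have := exR _ _ _ sGR lt_q qsG lt_l lsG.
    by rewrite [swap l q G]swapC swapK.
  - have := star_notin sGs lt_l lsG.
    by rewrite -eq_q [swap l q G]swapC swapK Gf.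
have muG : mu \notin G by move: GX; rewrite inE => /andP[].
have sGX := push_all GX lt_l lG; have muS := star_mu (subsetP XS _ sGX).
have [lt_q|lt_q|/val_inj ->] := ltngtP q mu.
- have qmu : mu != q by apply: contraTneq lt_q => ->; rewrite ltnn.
  apply: old.
    rewrite -(swap_swap lG muG qG) lcf ?(starS (subsetP XS _ sGX)) //.
    by rewrite in_swapD // eq_sym; apply: contraNneq qG => ->.
  by rewrite in_swapD // eq_sym.
- rewrite in_setU; apply/orP; right; rewrite inE in_swapD ?muG ?gt_neq //=.
  apply/existsP; exists q; rewrite lt_q in_swapR lG /=.
  by rewrite swap_swap.
- exact: oldX.
Qed.

(* Double counting of the pairs made of [F] in [X] and of a point above [mu] that
   replaces [mu] in [F]. *)
Lemma card_push i : (forall F, F \in X -> rank F = i) ->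
  #|push X| * (k.+1 - i) = #|X| * (N + i - (k + mu.+1)).
Proof.
move=> rX.
have -> : #|push X| * (k.+1 - i)
    = \sum_(G in push X) #|[set l : 'I_N | (mu < l) && (l \in G)]|.
  rewrite -sum_nat_const; apply: eq_bigr => G /pushE[F [l [FX lt_l lF ->]]].
  have Fs := subsetP XS _ FX.
  have := card_above (swap mu l F).
  have := card_swapI (initial N mu.+1) (star_mu Fs) lF.
  rewrite card_swap (uf (starS Fs)) -/(rank _) -/(rank _) (rX _ FX).
  by rewrite !inE !ltnS leqnn [l <= mu]leqNgt lt_l; clear; lia.
have -> : #|X| * (N + i - (k + mu.+1))
    = \sum_(F in X) #|[set l : 'I_N | (mu < l) && (l \notin F)]|.
  rewrite -sum_nat_const; apply: eq_bigr => F FX.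
  have := card_above_notin F; rewrite (uf (starS (subsetP XS _ FX))) (rX _ FX).
  by clear; lia.
rewrite !sum_card_rel; apply: eq_bigr => l _.
have [lt_l|ge_l] := ltnP mu l; last first.
  by rewrite !eq_card0 // => F; rewrite !inE andbF.
rewrite -[RHS](card_imset _ (can_inj (@swapK _ mu l))).
congr #|pred_of_set _|; apply/setP => G; rewrite in_set.
apply/andP/imsetP => [[GX lG]|[F]].
  exists (swap mu l G); last by rewrite swapK.
  by rewrite inE in_swapR swapC push_all //; move: GX; rewrite inE => /andP[].
rewrite inE => /andP[FX lF] ->; rewrite in_swapR push_swap //.
by rewrite (star_mu (subsetP XS _ FX)).
Qed.

Lemma card_replace : R \subset star ->
  #|(f :\: R) :|: push X| + #|R| = #|f| + #|push X|.
Proof.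
move=> RS; have Rf : R \subset f by apply: subset_trans RS _; apply/subsetP/starS.
have d0 : (f :\: R) :&: push X = set0.
  apply/setP => G; rewrite in_setI in_setD in_set0; apply/negP.
  by case/andP=> /andP[_ Gf] /push_notin; rewrite Gf.
rewrite cardsU d0 cards0 subn0 cardsD (setIidPr Rf).
by have := subset_leq_card Rf; clear; lia.
Qed.

End Push.

Lemma exchangeable_sub (P : pred {set 'I_N}) :
  (forall F (l q : 'I_N), mu < l -> l \in F -> mu < q -> q \notin F ->
     P F -> P (swap l q F)) ->
  exchangeable [set F in star | P F].
Proof.
move=> exP F l q /setIdP[Fs PF] lt_l lF lt_q qF.
apply/setIdP; split; [exact: exchangeable_star | exact: exP].
Qed.

Hypotheses (le_tk : t <= k) (bigN : k.*2.+2 <= N + t).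

Lemma star_rank_le F : F \in star -> [/\ rank F <= mu.+1, rank F <= k &
  k + mu.+1 < N + rank F].
Proof.
move=> Fs; have Ff := starS Fs; split.
- rewrite -[leqRHS](card_initial (ltn_ord mu)).
  exact: subset_leq_card (subsetIr _ _).
- by rewrite -(uf Ff); apply: subset_leq_card (subsetIl _ _).
have := Fs; rewrite inE => /and3P[_ _ /existsP[q /and3P[lt_q qF _]]].
have := card_above_notin F; rewrite (uf Ff) => <-.
rewrite -addnA -[ltnLHS]add0n ltn_add2r; apply/card_gt0P; exists q.
by rewrite inE lt_q.
Qed.

Definition star_level a := [set F in star | rank F == a].

(* Two traces meeting in [t] points either leave a point below [mu] uncovered, to which
   [mu] can be compressed, or have sizes adding up to [mu.+1 + t]: only
   [star_level j] has to be removed when [star_level i] is pushed. *)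
Lemma push_level_le i j : i != j -> i + j = mu.+1 + t ->
  #|star_level i| * (N + i - (k + mu.+1)) <= #|star_level j| * (k.+1 - i).
Proof.
move=> ij eij.
have iS a : star_level a \subset star by apply/subsetP => F /setIdP[].
have exS a : exchangeable (star_level a).
  by apply: exchangeable_sub => F l q *; rewrite rank_exchange.
have dS : [disjoint star_level i & star_level j].
  rewrite -setI_eq0; apply/eqP/setP => F; rewrite in_set0 in_setI.
  by apply: contraNF ij => /andP[/setIdP[_ /eqP <-] /setIdP[_ /eqP <-]].
rewrite -(@card_push _ (iS i) (exS i) i); last first.
  by move=> F /setIdP[_ /eqP].
rewrite leq_mul2r; apply/orP; right.
have [] := maxf; move=> _ /(_ (f :\: star_level j :|: push (star_level i))).
have := card_replace (iS i) (iS j); set h := #|_ :|: _| => ch maxh.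
suff /maxh : tfamily k t (f :\: star_level j :|: push (star_level i)).
  by move: ch; clear; lia.
apply: push_tfamily => // F H /setIdP[Fs /eqP rF] Hs rH cFH sFH.
have [/existsP[p /and3P[]]|] :=
  boolP [exists p : 'I_N, [&& p < mu, p \notin F & p \notin H]]; first by exists p.
rewrite negb_exists => /forallP cov; case/negP: rH; apply/setIdP; split=> //.
have muH := star_mu Hs; have muF := star_mu Fs.
have eU : (F :&: initial N mu.+1) :|: (H :&: initial N mu.+1) = initial N mu.+1.
  apply/setP => p; rewrite -setIUl !inE ltnS.
  have [lt_p|//|/val_inj ->] := ltngtP p mu; rewrite ?andbF // ?muF //.
  by move: (cov p); rewrite lt_p /= -negb_or negbK => ->.
have := cardsUI (F :&: initial N mu.+1) (H :&: initial N mu.+1).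
rewrite eU -setIIl (setIidPl sFH) cFH card_initial // -/(rank F) -/(rank H) rF.
by move: eij; clear; lia.
Qed.

(** If the rank [i] differed from [j = mu.+1 + t - i], then [push_level_le] would hold both for
    [i, j] and for [j, i]. As [i + j = mu.+1 + t], the bound on [N] makes both factors on the left
    exceed those of the opposite inequality on the right, so chaining the two is contradictory. *)
Lemma star_rank F : F \in star -> (rank F).*2 = mu.+1 + t.
Proof.
move=> Fs; have [le1 le2 lt3] := star_rank_le Fs.
set i := rank F in le1 le2 lt3 *; apply/eqP; apply: contraTT isT => ne.
pose j := mu.+1 + t - i.
have eij : i + j = mu.+1 + t by rewrite /j subnKC // (leq_trans le1) ?leq_addr.
have ij : i != j by apply: contraNneq ne => e; rewrite -addnn {2}e eij.
have := push_level_le ij eij; rewrite eq_sym addnC in ij eij *.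
have := push_level_le ij eij.
have : 0 < #|star_level i|.
  by apply/card_gt0P; exists F; apply/setIdP.
have : 0 < #|star_level j| -> j <= k /\ k + mu.+1 < N + j.
  move=> /card_gt0P[H /setIdP[Hs /eqP <-]].
  by case: (star_rank_le Hs).
move: #|star_level i| #|star_level j| => a b hb a0 ba ab.
have b0 : 0 < b.
  by move: ab; rewrite lt0n; apply: contraTneq => ->; rewrite mul0n leqn0 muln_eq0; lia.
have [lejk ltj] := hb b0.
have p1 : k.+1 - j < N + i - (k + mu.+1) by lia.
have p2 : k.+1 - i < N + j - (k + mu.+1) by lia.
have h1 := leq_trans (leq_mul (leqnn b) (ltnW p2)) ba.
by nia.
Qed.

Definition star_avoid (p : 'I_N) := [set F in star | p \notin F].

Lemma sum_star_avoid i : (forall F, F \in star -> rank F = i) ->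
  \sum_(p < N | p < mu) #|star_avoid p| = #|star| * (mu.+1 - i).
Proof.
move=> ri.
transitivity (\sum_(p < N) #|[set F in star | (p < mu) && (p \notin F)]|).
  rewrite big_mkcond; apply: eq_bigr => p _; case: (p < mu) => //=.
  by rewrite eq_card0 // => F; rewrite !inE andbF.
rewrite -(sum_card_rel star (fun F (p : 'I_N) => (p < mu) && (p \notin F))).
rewrite -sum_nat_const; apply: eq_bigr => F Fs.
have := cardsID F (initial N mu.+1); rewrite card_initial // setIC -/(rank F) ri //.
have -> : initial N mu.+1 :\: F = [set p : 'I_N | (p < mu) && (p \notin F)].
  apply/setP => p; rewrite !inE ltnS andbC.
  by case: ltngtP => // /val_inj ->; rewrite star_mu.
by move=> <-; rewrite addKn.
Qed.

(** [R] consists of the members of [star] containing [p]. All others miss [p], which therefore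
    serves as the uncovered point below [mu] that [push_tfamily] asks for. *)
Lemma star_avoid_replace (p : 'I_N) (X := star_avoid p) (R := star :\: X) :
  p < mu ->
  [/\ tfamily k t (f :\: R :|: push X), generated mu (f :\: R :|: push X),
     #|f :\: R :|: push X| + #|R| = #|f| + #|push X| & exchangeable X].
Proof.
move=> lt_p.
have XS : X \subset star by apply/subsetP => F /setIdP[].
have RS : R \subset star by apply: subsetDl.
have swp F (l q : 'I_N) : mu < l -> mu < q -> (p \in swap l q F) = (p \in F).
  move=> lt_l lt_q; apply: in_swapD.
    by apply: contraTneq lt_l => ->; rewrite ltnNge ltnW.
  by apply: contraTneq lt_q => ->; rewrite ltnNge ltnW.
have exX : exchangeable X.
  by apply: exchangeable_sub => F l q lt_l _ lt_q _; rewrite swp.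
have eR : R = [set F in star | p \in F].
  apply/setP => F; rewrite in_setD; apply/andP/setIdP => [[FX Fs]|[Fs pF]].
    by split=> //; apply: contraNT FX => pF; apply/setIdP.
  by split=> //; apply: contraL pF => /setIdP[].
have exR : exchangeable R.
  by rewrite eR; apply: exchangeable_sub => F l q lt_l _ lt_q _; rewrite swp.
have dXR : [disjoint X & R] by rewrite disjoint_sym disjoints_subset subsetDr.
split=> //.
- apply: push_tfamily => // F H /setIdP[Fs pF] Hs HR _ _.
  by exists p; split=> //; apply: contra HR => pH; rewrite eR; apply/setIdP.
- apply: push_generated => //; apply/subsetP => F Fs.
  by rewrite in_setU in_setD Fs andbT orbN.
- exact: card_replace.
Qed.

(* Comes from averaging over [p] the replacement of the members of [star] containing
   [p] by [push (star_avoid p)].  In the equality case some [p] costs nothing. *)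
Lemma star_bound F0 : 0 < t -> 0 < mu -> F0 \in star ->
  exists s, [/\ mu.+1 = t + s.*2,
    s * (N - (k.+1 - t).*2) <= t.-1 * (k.+1 - t) &
    s * (N - (k.+1 - t).*2) = t.-1 * (k.+1 - t) ->
      exists g : {set {set 'I_N}}, maximal k t g /\ generated mu g].
Proof.
move=> t0 mu0 F0s; have [le1 le2 lt3] := star_rank_le F0s.
have ri F : F \in star -> rank F = rank F0.
  by move=> Fs; apply: double_inj; rewrite !star_rank.
have ei := star_rank F0s.
move: (rank F0) => i in le1 le2 lt3 ri ei *.
have [[_ maxf'] lt_mu] := (maxf, ltn_ord mu).
have [A eA] : exists A, A = #|star| by exists #|star|.
have A0 : 0 < A by rewrite eA; apply/card_gt0P; exists F0.
have cX (p : 'I_N) : p < mu ->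
    #|push (star_avoid p)| * (k.+1 - i) = #|star_avoid p| * (N + i - (k + mu.+1)).
  move=> lt_p; have [_ _ _ exX] := star_avoid_replace lt_p.
  apply: card_push => //; first by apply/subsetP => F /setIdP[].
  by move=> F /setIdP[/ri].
have cR (p : 'I_N) : #|star :\: star_avoid p| + #|star_avoid p| = A.
  rewrite eA addnC -[RHS](cardsID (star_avoid p) star); congr (#|pred_of_set _| + _).
  by apply/esym/setIidPr/subsetP => F /setIdP[].
have sumX : \sum_(p < N | p < mu) #|star_avoid p| = A * (mu.+1 - i).
  by rewrite eA; apply: sum_star_avoid.
have sumc (c : nat) : \sum_(p < N | p < mu) c = mu * c.
  by rewrite -(big_ord_widen N (fun=> c) (ltnW lt_mu)) sum_nat_const card_ord.
(* By [star_rank], [i.*2 = mu.+1 + t]; hence [i - t] equals [mu.+1 - i], the number of points below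
   [mu] that a member of [star] misses. *)
exists (i - t).
have e1 : (k.+1 - i) + (N + i - (k + mu.+1)) = N - mu.
  by clear -le1 le2 lt3; lia.
have ub (p : 'I_N) : p < mu ->
    #|push (star_avoid p)| <= #|star :\: star_avoid p|.
  move=> lt_p; have [tg _ cg _] := star_avoid_replace lt_p.
  by move: cg (maxf' _ tg); clear; lia.
have le_i : (mu.+1 - i) * (N - mu) <= mu * (k.+1 - i).
  rewrite -(leq_pmul2l A0) mulnA -sumX mulnCA -sumc big_distrl /=.
  apply: leq_sum => p lt_p; rewrite -e1 mulnDr -(cR p) -cX // mulnDl addnC.
  by rewrite leq_add2r leq_mul2r ub ?orbT.
have ti : t <= i by clear -ei le1; lia.
have e2 : mu.+1 = t + (i - t).*2 by clear -ei ti; lia.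
have := star_bound_identity t0 e2 _ lt_mu bigN.
rewrite subnKC // => /(_ le2) ident.
have e3 : i - t = mu.+1 - i by clear -ei ti; lia.
rewrite -{}e3 in le_i sumX; split=> //; first by clear -ident le_i; lia.
move=> eq_s.
have [/existsP[p /andP[lt_p le_p]]|] := boolP
    [exists p : 'I_N, (p < mu) && (#|star :\: star_avoid p| <= #|push (star_avoid p)|)].
  have [tg gg cg _] := star_avoid_replace lt_p.
  exists (f :\: (star :\: star_avoid p) :|: push (star_avoid p)); split=> //.
  by split=> // h /maxf'; move: cg le_p; clear; lia.
rewrite negb_exists => /forallP nle.
suff : (i - t) * (N - mu) < mu * (k.+1 - i) by clear -ident eq_s; lia.
rewrite -(ltn_pmul2l A0) mulnA -sumX mulnCA -sumc big_distrl /=.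
have lt_one (p : 'I_N) : p < mu -> #|star_avoid p| * (N - mu) < A * (k.+1 - i).
  move=> lt_p; rewrite -e1 mulnDr -(cR p) -cX // mulnDl addnC.
  rewrite ltn_add2r ltn_mul2r subn_gt0 ltnS le2 /= ltnNge.
  by have := nle p; rewrite lt_p.
have lt0N : 0 < N by apply: leq_ltn_trans lt_mu.
(* Since [0 < mu], the point [0] occurs in the sum and supplies a strict term. *)
rewrite (bigD1 (Ordinal lt0N)) //= [ltnRHS](bigD1 (Ordinal lt0N)) //= -addSn.
rewrite leq_add ?lt_one // leq_sum // => p /andP[lt_p _].
exact/ltnW/lt_one.
Qed.

End Star.

Lemma generatedN N (f : {set {set 'I_N}}) : generated N f.
Proof. by move=> F l q _; rewrite leqNgt ltn_ord. Qed.

Lemma star0_generated N (mu : 'I_N) (f : {set {set 'I_N}}) :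
  left_compressed f -> generated mu.+1 f -> star mu f = set0 -> generated mu f.
Proof.
move=> lcf genf s0 F l q Ff; rewrite leq_eqVlt; case/predU1P=> [/val_inj <-|].
  move=> muF qF; have [lt_q|lt_q|/val_inj eq_q] := ltngtP q mu.
  - exact: lcf.
  - by apply: notin_star; rewrite ?s0 ?inE.
  - by rewrite eq_q muF in qF.
exact: genf.
Qed.

(** * Descent on the number of generating points *)

Section Descent.
Variables (N k t r : nat).
Hypotheses (t_gt0 : 0 < t) (le_tk : t <= k) (bigN : k.*2.+2 <= N + t).

(** A nonempty [star] at some [mu >= t + r.*2] would give an [s > r] in [star_bound], against the
    strict inequality. The family itself stays unchanged. *)
Lemma generated_strict (f : {set {set 'I_N}}) m :
  t.-1 * (k.+1 - t) < r.+1 * (N - (k.+1 - t).*2) ->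
  maximal k t f -> left_compressed f -> t + r.*2 <= m <= N -> generated m f.
Proof.
move=> lt_r maxf lcf; have [d] := ubnP (N - m).
elim: d m => // d IH m lt_d /andP[le_m le_mN].
have [lt_mN|ge_mN] := ltnP m N; last first.
  by rewrite (_ : m = N); [exact: generatedN | lia].
have genf : generated m.+1 f by apply: IH; lia.
pose mu := Ordinal lt_mN.
apply: (@star0_generated N mu) => //; apply/eqP; apply: contraTT isT => /set0Pn[F Fs].
have mu0 : 0 < mu by rewrite /mu /=; lia.
have [s [/= e le_s _]] :=
  star_bound (mu := mu) maxf lcf genf le_tk bigN t_gt0 mu0 Fs.
have lt_s : r.+1 <= s by lia.
have := leq_trans (leq_mul lt_s (leqnn (N - (k.+1 - t).*2))) le_s.
by rewrite leqNgt lt_r.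
Qed.

(** With equality allowed, [star] may be nonempty; [star_bound] is then an equality and supplies
    another maximal family, which is compressed again. *)
Lemma ex_generated m :
  t.-1 * (k.+1 - t) <= r.+1 * (N - (k.+1 - t).*2) ->
  t + r.*2 <= m <= N ->
  exists f : {set {set 'I_N}},
    [/\ maximal k t f, generated m f & left_compressed f].
Proof.
move=> le_r; have [d] := ubnP (N - m).
elim: d m => // d IH m lt_d /andP[le_m le_mN].
have [lt_mN|ge_mN] := ltnP m N; last first.
  have [f maxf] := ex_maximal N k t.
  by rewrite (_ : m = N); [exact: ex_compressed maxf (@generatedN _ _) | lia].
have [|//|f [maxf genf lcf]] := IH m.+1; [lia.. |].
pose mu := Ordinal lt_mN.
have [s0|[F Fs]] := set_0Vmem (star mu f).
  by exists f; split=> //; apply: (@star0_generated N mu).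
have mu0 : 0 < mu by rewrite /mu /=; lia.
have [s [/= e le_s eq_s]] :=
  star_bound (mu := mu) maxf lcf genf le_tk bigN t_gt0 mu0 Fs.
have lt_s : r.+1 <= s by lia.
have ge_s := leq_trans le_r (leq_mul lt_s (leqnn (N - (k.+1 - t).*2))).
have [|g [maxg geng]] := eq_s; first by apply/eqP; rewrite eqn_leq le_s.
exact: ex_compressed maxg geng.
Qed.

End Descent.

(** * Duality by complements *)

Section Dual.
Variable N : nat.
Implicit Types (F G H : {set 'I_N}) (f g : {set {set 'I_N}}).

(* Complements are taken in reversed order, so that left-compressed families are
   mapped to left-compressed families. *)
Definition mirror F : {set 'I_N} := [set x | rev_ord x \notin F].

Definition dual f : {set {set 'I_N}} := mirror @^-1: f.

Lemma mirrorK : involutive mirror.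
Proof. by move=> F; apply/setP => x; rewrite !inE rev_ordK negbK. Qed.

Lemma card_mirror F : #|mirror F| + #|F| = N.
Proof.
have -> : mirror F = ~: (@rev_ord N @^-1: F) by apply/setP => x; rewrite !inE.
rewrite -(card_preimset F (@rev_ord_inj N)) addnC cardsC card_ord //.
Qed.

Lemma card_mirrorI F H : #|mirror F :&: mirror H| + #|F| + #|H| = N + #|F :&: H|.
Proof.
have -> : mirror F :&: mirror H = mirror (F :|: H).
  by apply/setP => x; rewrite !inE negb_or.
by have := card_mirror (F :|: H); have := cardsUI F H; lia.
Qed.

Lemma mirror_swap a b F : mirror (swap a b F) = swap (rev_ord a) (rev_ord b) (mirror F).
Proof.
apply/setP => x; rewrite !inE (inj_tperm _ _ _ (@rev_ord_inj N)).
by rewrite !rev_ordK.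
Qed.

Lemma card_dual f : #|dual f| = #|f|.
Proof. exact: (card_preimset _ (can_inj mirrorK)). Qed.

Lemma dual_tfamily k t f : k <= N -> k.*2 <= N + t ->
  tfamily (N - k) (N + t - k.*2) f -> tfamily k t (dual f).
Proof.
move=> le_kN le_2k /tfamilyP[uf tf]; apply/tfamilyP; split=> [F|F H].
  by rewrite inE => /uf; have := card_mirror F; lia.
rewrite !inE => Ff Hf; have := tf _ _ Ff Hf; have := card_mirrorI F H.
by have := card_mirror F; have := card_mirror H; rewrite (uf _ Ff) (uf _ Hf); lia.
Qed.

Lemma dual_maximal k t f : k <= N -> k.*2 <= N + t -> t <= k ->
  maximal (N - k) (N + t - k.*2) f -> maximal k t (dual f).
Proof.
move=> le_kN le_2k le_tk [tf maxf]; split; first exact: dual_tfamily.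
move=> g tg; rewrite card_dual -(card_dual g); apply/maxf/dual_tfamily => //; try lia.
have -> : N - (N - k) = k by lia.
by have -> : N + (N + t - k.*2) - (N - k).*2 = t by lia.
Qed.

Lemma dual_compressed f : left_compressed f -> left_compressed (dual f).
Proof.
move=> lcf F i j; rewrite !inE => Ff lt_ij jF iF.
rewrite mirror_swap swapC lcf // ?inE ?rev_ordK ?jF //=.
by have := ltn_ord j; lia.
Qed.

(** [rev_ord] sends the first [N - m] points to those from [m] on, which [f] exchanges freely. *)
Lemma dual_generated m f F (l q : 'I_N) : generated m f -> F \in dual f ->
  l < N - m -> q < N - m -> l \in F -> q \notin F -> swap l q F \in dual f.
Proof.
move=> genf; rewrite !inE => Ff lt_l lt_q lF qF.
rewrite mirror_swap swapC genf // ?inE ?rev_ordK ?lF //=.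
by lia.
Qed.

End Dual.

Lemma symmetric_closed N m (f : {set {set 'I_N}}) (F F' : {set 'I_N}) :
  generated m f ->
  (forall (G : {set 'I_N}) (l q : 'I_N), G \in f -> l < m -> q < m ->
     l \in G -> q \notin G -> swap l q G \in f) ->
  F \in f -> #|F'| = #|F| ->
  #|F :&: initial N m| <= #|F' :&: initial N m| -> F' \in f.
Proof.
move=> genf symf; have [d] := ubnP #|F :\: F'|.
elim: d F => // d IH F lt_d Ff eF leF.
have [s0|[l0 l0D]] := set_0Vmem (F :\: F').
  suff -> : F' = F by [].
  by apply/esym/eqP; rewrite eqEcard eF leqnn andbT -finset.setD_eq0 s0.
have eD : #|F :\: F'| = #|F' :\: F|.
  by have := cardsID F' F; have := cardsID F F'; rewrite setIC eF; lia.
have [q0 q0D] : exists q, q \in F' :\: F.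
  by apply/card_gt0P; rewrite -eD; apply/card_gt0P; exists l0.
have step (l q : 'I_N) : l \in F :\: F' -> q \in F' :\: F ->
    swap l q F \in f -> (l < m -> q < m) ->
    (m <= l -> q < m -> #|F :&: initial N m| < #|F' :&: initial N m|) -> F' \in f.
  rewrite !inE => /andP[lF' lF] /andP[qF qF'] sf h1 h2.
  apply: (IH (swap l q F)) => //; last 1 first.
  - have := card_swapI (initial N m) lF qF; rewrite !inE.
    have [lt_l|ge_l] := ltnP l m; first by rewrite h1 //; clear -leF; lia.
    by have [lt_q|ge_q] := ltnP q m; [have := h2 ge_l lt_q; clear; lia|clear -leF; lia].
  - have := card_swapI (~: F') lF qF; rewrite !inE lF' qF' -!setDE.
    by clear -lt_d; lia.
  - by rewrite card_swap.
have symstep (l q : 'I_N) : l \in F :\: F' -> q \in F' :\: F ->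
    l < m -> q < m -> F' \in f.
  move=> lD qD lt_l lt_q; apply: (step l q) => //; last by rewrite leqNgt lt_l.
  by move: lD qD; rewrite !inE => /andP[lF' lF] /andP[qF qF']; apply: symf.
have genstep (l q : 'I_N) : l \in F :\: F' -> q \in F' :\: F ->
    m <= l -> m <= q -> F' \in f.
  move=> lD qD ge_l ge_q; apply: (step l q) => //; last 1 first.
  - by move=> _; rewrite ltnNge ge_q.
  - by move: lD qD; rewrite !inE => /andP[lF' lF] /andP[qF qF']; apply: genf.
  - by rewrite ltnNge ge_l.
move: (l0D) (q0D); rewrite !inE => /andP[l0F' l0F] /andP[q0F q0F'].
have [lt_l|ge_l] := ltnP l0 m; have [lt_q|ge_q] := ltnP q0 m.
- exact: (symstep l0 q0).
(* If no pair lies on one side of [m], then [F :\: F'] is below [m] and [F' :\: F] is not, so [F]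
   has the larger trace, against [leF]. *)
- have [/exists_inP[l lD ge_l]|] := boolP [exists l in F :\: F', m <= l].
    exact: (genstep l q0).
  rewrite negb_exists_in => /forall_inP nl.
  have [/exists_inP[q qD lt_q]|] := boolP [exists q in F' :\: F, q < m].
    exact: (symstep l0 q).
  rewrite negb_exists_in => /forall_inP nq.
  suff : #|F' :&: initial N m| < #|F :&: initial N m| by rewrite ltnNge leF.
  apply: proper_card; apply/properP; split.
    apply/subsetP => x; rewrite !inE => /andP[xF' lt_x]; rewrite lt_x andbT.
    by apply: contraTT lt_x => xF; apply: nq; rewrite inE xF.
  by exists l0; rewrite !inE ?l0F // (negbTE l0F').
- have [/exists_inP[q qD ge_q]|] := boolP [exists q in F' :\: F, m <= q].
    exact: (genstep l0 q).
  rewrite negb_exists_in => /forall_inP nq.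
  have [/exists_inP[l lD lt_l]|] := boolP [exists l in F :\: F', l < m].
    exact: (symstep l q0).
  rewrite negb_exists_in => /forall_inP nl.
  apply: (step l0 q0) => //; first by apply: genf.
  move=> _ _; apply: proper_card; apply/properP; split.
    apply/subsetP => x; rewrite !inE => /andP[xF lt_x]; rewrite lt_x andbT.
    apply: contraTT lt_x => xF'; rewrite -leqNgt leqNgt; apply: nl.
    by rewrite inE xF'.
  by exists q0; rewrite !inE ?q0F' // (negbTE q0F).
- exact: (genstep l0 q0).
Qed.

(* Otherwise the family contains all [k]-sets with at least [t + r - 1] points among
   the first [t + 2r], and two of them meet in fewer than [t] points. *)
Lemma closed_sub_A_fam N k t r (f : {set {set 'I_N}}) :
  0 < t -> t + r <= k -> k.*2.+2 <= N + t -> tfamily k t f ->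
  generated (t + r.*2) f ->
  (forall (G : {set 'I_N}) (l q : 'I_N), G \in f ->
     l < t + r.*2 -> q < t + r.*2 -> l \in G -> q \notin G -> swap l q G \in f) ->
  f \subset A_fam N k t r.
Proof.
move=> t0 le_k big /tfamilyP[uf tf] genf symf; apply/subsetP => F Ff.
rewrite inE uf // eqxx mul2n /=; rewrite leqNgt; apply/negP => lt_r.
set m := t + r.*2 in genf symf lt_r *; pose a := t + r - 1.
(* The parts of [A] and [B] beyond [m] are disjoint, as [m + (k - a).*2 <= N]. Within the first [m]
   points they share [a.*2 - m], that is [t - 2] points, truncated to 0 for [t = 1]. *)
pose A : {set 'I_N} :=
  [set j : 'I_N | 0 <= j < a] :|: [set j : 'I_N | m <= j < m + (k - a)].
pose B : {set 'I_N} :=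
  [set j : 'I_N | m - a <= j < m] :|: [set j : 'I_N | N - (k - a) <= j < N].
have closed (G : {set 'I_N}) : #|G| = k -> a <= #|G :&: initial N m| -> G \in f.
  move=> cG le_a; apply: (symmetric_closed genf symf Ff); first by rewrite cG uf.
  by apply: leq_trans le_a; rewrite /a subn1 -ltnS prednK ?addn_gt0 ?t0.
have cardU (b c d e : nat) : c <= d -> c <= N -> e <= N ->
    #|[set j : 'I_N | b <= j < c] :|: [set j : 'I_N | d <= j < e]| = (c - b) + (e - d).
  move=> lecd lec lee; rewrite cardsU !card_interval //.
  rewrite (_ : _ :&: _ = set0) ?cards0 ?subn0 //.
  by apply/setP => x; rewrite !inE; clear -lecd; lia.
have interI (G : {set 'I_N}) b :
    [set j : 'I_N | b <= j < b + a] \subset G -> b + a <= m -> m <= N -> a <= #|G :&: initial N m|.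
  move=> sG le_m le_N; have <- : #|[set j : 'I_N | b <= j < b + a]| = a.
    by rewrite card_interval ?addKn // (leq_trans le_m).
  apply: subset_leq_card; rewrite subsetI sG; apply/subsetP => x; rewrite !inE.
  by clear -le_m; lia.
have AA : A \in f.
  apply: closed; first by rewrite cardU /a /m; clear -t0 le_k big; lia.
  apply: (interI _ 0); rewrite /a /m; try by clear -t0 le_k big; lia.
  exact: subsetUl.
have BB : B \in f.
  apply: closed; first by rewrite cardU /a /m; clear -t0 le_k big; lia.
  apply: (interI _ (m - a)); rewrite /a /m; try by clear -t0 le_k big; lia.
  rewrite subnK; last by clear -t0; lia.
  exact: subsetUl.
have := tf _ _ AA BB; rewrite leqNgt; apply/negP; rewrite negbK.
suff : #|A :&: B| <= #|[set j : 'I_N | m - a <= j < a]|.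
  by rewrite card_interval /a /m; clear -t0 le_k big; lia.
apply/subset_leq_card/subsetP => x; rewrite !inE /a /m.
by clear -t0 le_k big; lia.
Qed.

Lemma tfamily_full N k t (f : {set {set 'I_N}}) :
  k <= t -> tfamily k t f -> #|f| <= 1.
Proof.
move=> le_kt /tfamilyP[uf tf]; apply/card_le1_eqP => F H Ff Hf; apply/eqP.
have eI (G G' : {set 'I_N}) : G \in f -> G' \in f -> G :&: G' = G.
  move=> Gf Gf'; apply/eqP; rewrite eqEcard subsetIl uf //.
  exact: leq_trans le_kt (tf _ _ Gf Gf').
by rewrite -(eI F H) // setIC eI.
Qed.

Lemma A_fam_gt0 N k t : t <= k <= N -> 0 < #|A_fam N k t 0|.
Proof.
move=> /andP[le_tk le_kN]; apply/card_gt0P; exists (initial N k).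
rewrite inE card_initial // eqxx /= muln0 !addn0.
rewrite (setIidPr _); first by rewrite card_initial // (leq_trans le_tk).
by apply/subsetP => x; rewrite !inE => lt_x; apply: leq_trans lt_x le_tk.
Qed.

(** [r] is least with [t.-1 * (k.+1 - t) < r.+1 * D]. Strictness makes every compressed maximal
    family generated by the first [t + r.*2] points. Minimality is the nonstrict condition for the
    dual parameters, so some such family is also symmetric on these points. *)
Theorem complete_intersection N k t (f : {set {set 'I_N}}) :
  0 < t -> t <= k -> k.*2.+2 <= N + t -> tfamily k t f -> #|f| <= AK N k t.
Proof.
move=> t0 le_tk big tf.
pose D := N - (k.+1 - t).*2.
have D0 : t.-1 < D by rewrite /D; lia.
have exr : exists r, t.-1 * (k.+1 - t) < r.+1 * D.
  by exists (k - t); rewrite -subSn // mulnC ltn_pmul2l // subn_gt0 ltnS.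
case: (ex_minnP exr) => r lt_r min_r.
have le_r : r <= k - t.
  by apply: min_r; rewrite -subSn // mulnC ltn_pmul2l // subn_gt0 ltnS.
have le_rD : r * D <= t.-1 * (k.+1 - t).
  case: r min_r {lt_r le_r} => // r min_r.
  by rewrite leqNgt; apply/negP => /min_r; rewrite ltnn.
have le_m : t + r.*2 <= N by lia.
suff [g [maxg geng symg]] : exists g : {set {set 'I_N}},
    [/\ maximal k t g, generated (t + r.*2) g &
      forall (G : {set 'I_N}) (l q : 'I_N), G \in g ->
        l < t + r.*2 -> q < t + r.*2 -> l \in G -> q \notin G -> swap l q G \in g].
  have [tg max_g] := maxg.
  apply: leq_trans (max_g _ tf) (leq_trans _ (leq_AK N k t r)).
  apply: subset_leq_card; apply: closed_sub_A_fam => //.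
  by rewrite -leq_subRL.
(* The dual parameters satisfy the bound on [N] only if [2 <= t]. For [t = 1], [r] is 0 and symmetry
   on a single point is trivial. *)
have [t1|t1] := leqP t 1.
  have [h maxh] := ex_maximal N k t.
  have [g [maxg _ lcg]] := ex_compressed maxh (@generatedN _ h).
  exists g; split=> //.
    by apply: generated_strict lt_r maxg lcg _; rewrite ?leqnn.
  have t1' : t = 1 by lia.
  have r0 : r = 0.
    by apply/eqP; rewrite -leqn0 min_r // t1' mul0n mul1n; lia.
  move=> G l q _; rewrite t1' r0 => lt_l lt_q lG.
  by rewrite (_ : q = l) ?lG //; apply: val_inj => /=; lia.
have le_kN : k <= N by lia.
have le_2k : k.*2 <= N + t by lia.
have ek : (N - k).+1 - (N + t - k.*2) = k.+1 - t by lia.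
have em : (N + t - k.*2) + (k - t - r).*2 = N - (t + r.*2) by lia.
have [|||||h [maxh genh lch]] :=
  @ex_generated N (N - k) (N + t - k.*2) (k - t - r) _ _ _
    (N - (t + r.*2)); [clear -big le_tk le_kN t1; lia.. | | clear -le_m em; lia |].
(* With [c = k.+1 - t], the dual condition [(D - t.-1) * c <= (c - r) * D] follows from
   [r * D <= t.-1 * c]. *)
- rewrite ek -/D.
  have -> : (N + t - k.*2).-1 = D - t.-1 by rewrite /D; lia.
  have -> : (k - t - r).+1 = (k.+1 - t) - r by lia.
  clearbody D; move: (k.+1 - t) le_rD => c le_rD.
  by rewrite !mulnBl [D * _]mulnC leq_sub2l.
exists (dual h); split.
- exact: dual_maximal.
- apply: generated_strict lt_r _ (dual_compressed lch) _ => //.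
    exact: dual_maximal.
  by rewrite leqnn.
move=> G l q Gh lt_l lt_q; apply: dual_generated genh Gh _ _; by rewrite subKn.
Qed.

(** This case lies just outside [complete_intersection]. An intersecting family has at most one set
    of each complementary pair, so complementing the members that miss the point [0] injects it into
    the [k]-sets containing [0]. *)
Lemma intersecting_half k (f : {set {set 'I_(k.*2)}}) :
  0 < k -> tfamily k 1 f -> #|f| <= AK k.*2 k 1.
Proof.
move=> k0 /tfamilyP[uf tf]; apply: leq_trans (leq_AK _ _ _ 0).
have lt0 : 0 < k.*2 by rewrite double_gt0.
pose z := Ordinal lt0; pose c (F : {set 'I_(k.*2)}) := if z \in F then F else ~: F.
have zc F : z \in c F by rewrite /c; case: ifPn => //; rewrite inE.
have nC F : F \in f -> ~: F \notin f.
  by move=> Ff; apply/negP => /(tf _ _ Ff); rewrite setICr cards0.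
rewrite -(card_in_imset (f := c)); last first.
  move=> F G Ff Gf; rewrite /c; case: ifP; case: ifP => // _ _.
  - by move=> eF; move: Ff; rewrite eF (negbTE (nC _ Gf)).
  - by move=> eG; move: Gf; rewrite -eG (negbTE (nC _ Ff)).
  - exact: setC_inj.
apply/subset_leq_card/subsetP => _ /imsetP[F Ff ->].
rewrite inE; apply/andP; split.
  rewrite /c; case: ifP => _; first by rewrite uf.
  by have := cardsC F; rewrite card_ord uf //; clear; lia.
by rewrite muln0 !addn0; apply/card_gt0P; exists z; rewrite inE zc inE.
Qed.

(** * From multisets to sets *)

Section Kernel.
Variables (n k : nat).
Local Notation M := {ffun 'I_n -> 'I_k.+1}.
Implicit Types (F G : M) (c : 'I_n -> nat) (g : {set M}).

Definition msum F := \sum_(x < n) F x.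

(* Intersections are computed with the multiplicities truncated at [c]. *)
Definition kint c F G := \sum_(x < n) minn (minn (F x) (G x)) (c x).

Definition kfamily t c g :=
  (forall F, F \in g -> msum F = k) /\
  (forall F G, F \in g -> G \in g -> t <= kint c F G).

Section Move.
Variables (i j : 'I_n) (d : nat).
Hypotheses (ij : i != j) (d0 : 0 < d).

(** [move] exchanges the two configurations: the surplus over [d.-1] at [i] goes to the empty [j],
    or is merged back. The bound in [low] keeps the merged multiplicity in ['I_k.+1]. *)
Definition high F := (d <= F i) && (F j == 0 :> nat).
Definition low F := [&& F i == d.-1 :> nat, 0 < F j & F i + F j <= k].

Definition move_val F (x : 'I_n) : nat :=
  if high F then if x == i then d.-1 else if x == j then F i - d.-1 else F x
  else if low F then if x == i then F i + F j else if x == j then 0 else F x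
  else F x.

Definition move F : M := [ffun x => inord (move_val F x)].

Lemma moveE F x : move F x = move_val F x :> nat.
Proof.
rewrite ffunE inordK // ltnS /move_val.
have := ltn_ord (F i); have := ltn_ord (F x); rewrite !ltnS.
case: ifP => [/andP[h _] hx hi|_]; first by case: ifP => _; [|case: ifP => _]; lia.
by case: ifP => [/and3P[_ _ h] hx hi|//]; case: ifP => _ //; case: ifP.
Qed.

Let ji : j != i. Proof. by rewrite eq_sym. Qed.

Lemma move_i F : move F i = (if high F then d.-1 else
  if low F then F i + F j else F i) :> nat.
Proof. by rewrite moveE /move_val eqxx. Qed.

Lemma move_j F : move F j = (if high F then F i - d.-1 else
  if low F then 0 else F j) :> nat.
Proof. by rewrite moveE /move_val eqxx (negbTE ji). Qed.

Lemma move_x F x : x != i -> x != j -> move F x = F x :> nat.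
Proof.
move=> xi xj; rewrite moveE /move_val (negbTE xi) (negbTE xj).
by do 2?case: ifP.
Qed.

Lemma high_low F : high F -> ~~ low F.
Proof. by case/andP=> _ /eqP e; rewrite /low e andbF. Qed.

Lemma high_move F : high (move F) = low F.
Proof.
rewrite {1}/high move_i move_j; have := @high_low F.
case: (boolP (high F)) => [/andP[h1 h2] /(_ isT)/negbTE ->|nh _]; first by lia.
case: (boolP (low F)) => [/and3P[l1 l2 l3]|nl]; first by lia.
exact: negbTE nh.
Qed.

Lemma low_move F : low (move F) = high F.
Proof.
rewrite {1}/low move_i move_j; have := @high_low F.
case: (boolP (high F)) => [/andP[h1 h2] _|nh _].
  by have := ltn_ord (F i); lia.
case: (boolP (low F)) => [/and3P[l1 l2 l3]|nl]; first by lia.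
exact: negbTE nl.
Qed.

Lemma moveK : involutive move.
Proof.
move=> F; apply/ffunP => x; apply: val_inj => /=.
have [->|xi] := eqVneq x i; [|have [->|xj] := eqVneq x j].
- rewrite move_i high_move low_move move_i move_j; have := @high_low F.
  case: (boolP (high F)) => [/andP[h1 h2] /(_ isT)/negbTE ->|nh _]; first by lia.
  by case: (boolP (low F)) => [/and3P[l1 l2 l3]|nl]; lia.
- rewrite move_j high_move low_move move_i move_j; have := @high_low F.
  case: (boolP (high F)) => [/andP[h1 h2] /(_ isT)/negbTE ->|nh _]; first by lia.
  by case: (boolP (low F)) => [/and3P[l1 l2 l3]|nl]; lia.
- by rewrite !move_x.
Qed.

Lemma move_fix F : ~~ high F -> ~~ high (move F) -> move F = F.
Proof.
rewrite high_move => nh nl; apply/ffunP => x; apply: val_inj => /=.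
by rewrite moveE /move_val (negbTE nh) (negbTE nl).
Qed.

Lemma sum_split (u : 'I_n -> nat) :
  \sum_(x < n) u x = u i + u j + \sum_(x < n | (x != i) && (x != j)) u x.
Proof. by rewrite (bigD1 i) //= (bigD1 j) //= addnA. Qed.

Lemma msum_move F : msum (move F) = msum F.
Proof.
rewrite /msum !sum_split; congr (_ + _); last first.
  by apply: eq_bigr => x /andP[xi xj]; rewrite move_x.
rewrite move_i move_j; have := @high_low F.
case: (boolP (high F)) => [/andP[h1 h2] _|nh _]; first by lia.
by case: (boolP (low F)) => [/and3P[l1 l2 l3]|nl]; lia.
Qed.

Lemma kintC c F G : kint c F G = kint c G F.
Proof. by apply: eq_bigr => x _; rewrite (minnC (F x)). Qed.

(** If [G] is low, the truncated count at [i] rises from [d.-1] to at most [d], while a positive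
    count at [j] is lost. If [G] is high, the counts stay [d.-1] and 0. *)
Lemma kint_move2 c F G : c i = d -> 0 < c j -> low F -> high G || low G ->
  kint c (move F) (move G) <= kint c F G.
Proof.
move=> ci cj lF hG; rewrite /kint !sum_split.
have e : \sum_(x < n | (x != i) && (x != j)) minn (minn (move F x) (move G x)) (c x)
       = \sum_(x < n | (x != i) && (x != j)) minn (minn (F x) (G x)) (c x).
  by apply: eq_bigr => x /andP[xi xj]; rewrite !move_x.
rewrite {}e leq_add2r !move_i !move_j ci lF.
have -> : high F = false by apply: contraTF lF; apply: high_low.
move: lF hG => /and3P[/eqP l1 l2 l3] /orP[hG|lG].
  rewrite hG; move: hG => /andP[h1 /eqP h2]; rewrite h2.
  by clear -l1 h1 d0; lia.
have -> : high G = false by apply: contraTF lG; apply: high_low.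
rewrite lG; move: lG => /and3P[/eqP m1 m2 _]; clear -l1 l2 m1 m2 d0 cj; lia.
Qed.

(** The count at [i] rises by at most one, and only if [d <= G i]. Then [G j] is positive because
    [G] is not high, so a positive count at [j] is lost. *)
Lemma kint_move1 c F G : c i = d -> 0 < c j -> low F -> ~~ high G ->
  kint c (move F) G <= kint c F G.
Proof.
move=> ci cj lF hG; rewrite /kint !sum_split.
have e : \sum_(x < n | (x != i) && (x != j)) minn (minn (move F x) (G x)) (c x)
       = \sum_(x < n | (x != i) && (x != j)) minn (minn (F x) (G x)) (c x).
  by apply: eq_bigr => x /andP[xi xj]; rewrite !move_x.
rewrite {}e leq_add2r !move_i !move_j ci lF.
have -> : high F = false by apply: contraTF lF; apply: high_low.
move: lF hG => /and3P[/eqP l1 l2 l3]; rewrite /high.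
by clear -l1 l2 d0 cj; lia.
Qed.

Lemma shift_kfamily t c g : c i = d -> 0 < c j ->
  kfamily t c g -> kfamily t c (shift move high g).
Proof.
move=> ci cj [sg tg]; split.
  move=> F; rewrite inE; case: ifP => _; first by case/andP=> /sg.
  by case/orP=> /sg //; rewrite msum_move.
apply: (@shift_rel _ _ _ moveK move_fix (fun F G => t <= kint c F G)) => //.
- by move=> F G; rewrite kintC.
- by move=> F G; rewrite !high_move => lF hG /leq_trans; apply; apply: kint_move2.
- by move=> F G; rewrite high_move => lF hG /leq_trans; apply; apply: kint_move1.
Qed.

End Move.

(* If lowering the threshold at [i] hurts [F] and [G], both have at least two copies of
   [i], so that their supports miss a common [j] and [move i j (c i) F] contradicts
   [F] and [G] being [t]-intersecting. *)
Lemma lower_kernel t c (i : 'I_n) g :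
  k.*2 <= n + t -> (forall x, 0 < c x) -> 1 < c i -> kfamily t c g ->
  exists2 g' : {set M}, #|g'| = #|g| &
    kfamily t (fun x => if x == i then (c i).-1 else c x) g'.
Proof.
move=> le_kn c0 ci1 fg.
pose J := {j : 'I_n | i != j}.
have [||||||g' [[sg tg] cg st]] := @shift_stable M J (fun j => move i (val j) (c i))
    (fun j => high i (val j) (c i)) (fun F => F i) (kfamily t c) g.
- by move=> j; apply: moveK (valP j) (c0 i).
- move=> j F hF; rewrite (high_move (valP j) (c0 i)).
  by apply: contraL hF; apply: contraL; apply: high_low.
- by move=> j F; apply: move_fix (valP j) (c0 i) _.
- move=> j F hF; rewrite (move_i (valP j) (c0 i)) hF.
  by move: hF => /andP[h _]; rewrite (leq_trans _ h) // ltn_predL.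
- by move=> j h; apply: shift_kfamily (valP j) (c0 i) _ _ _ _ _.
- exact: fg.
exists g' => //; split=> // F G Fg Gg.
have kintE (H H' : M) d :
    \sum_(x < n) minn (minn (H x) (H' x)) (if x == i then d else c x)
    = minn (minn (H i) (H' i)) d + \sum_(x < n | x != i) minn (minn (H x) (H' x)) (c x).
  rewrite (bigD1 i) //= eqxx; congr (_ + _); apply: eq_bigr => x xi.
  by rewrite (negbTE xi).
rewrite leqNgt /kint kintE; apply/negP => lt_t.
have := tg _ _ Fg Gg; rewrite /kint (bigD1 i) //= => ge_t.
have [le_F le_G] : c i <= F i /\ c i <= G i.
  by move: lt_t ge_t; move: (bigop _ _ _) => S; clear; lia.
have [j /andP[Fj Gj]] : exists j, (F j == 0 :> nat) && (G j == 0 :> nat).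
  apply/existsP; apply: contraT; rewrite negb_exists => /forallP ne0.
  have h1 : \sum_(x < n) maxn (F x) (G x) + \sum_(x < n) minn (F x) (G x) = k.*2.
    rewrite -[RHS]addnn -[X in _ = X + _](sg _ Fg) -[X in _ = _ + X](sg _ Gg).
    by rewrite /msum -!big_split; apply: eq_bigr => x _; clear; rewrite /=; lia.
  have h2 : t <= \sum_(x < n) minn (F x) (G x).
    apply: leq_trans (tg _ _ Fg Gg) _.
    by apply: leq_sum => x _; apply: geq_minl.
  (* If the supports covered every point, the maxima would sum to more than [n], as [i] contributes
     at least 2; but [h1] and [h2] bound the sum by [2k - t]. *)
  suff : n < \sum_(x < n) maxn (F x) (G x) by clear -h1 h2 le_kn; lia.
  rewrite -[ltnLHS]card_ord -sum1_card (bigD1 i) //= [ltnRHS](bigD1 i) //= -addSn.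
  rewrite leq_add ?leq_max ?(leq_trans ci1 le_F) // leq_sum // => x _.
  by have := ne0 x; rewrite leq_max !lt0n negb_and.
have ij : i != j by apply: contraTneq Fj => <-; rewrite -lt0n (leq_trans (c0 i)).
have hF : high i j (c i) F by rewrite /high le_F Fj.
have mF := st (exist _ j ij) F Fg hF.
have := tg _ _ mF Gg; rewrite /= /kint (bigD1 i) //= (bigD1 j) 1?eq_sym //=.
rewrite move_i // move_j // hF (eqP Gj).
move: lt_t; rewrite (bigD1 j) 1?eq_sym //= (eqP Fj) (eqP Gj).
have -> :
    \sum_(x < n | (x != i) && (x != j)) minn (minn (move i j (c i) F x) (G x)) (c x)
       = \sum_(x < n | (x != i) && (x != j)) minn (minn (F x) (G x)) (c x).
  by apply: eq_bigr => x /andP[xi xj]; rewrite move_x.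
by move: (bigop _ _ _) => S; clear -le_G le_F; lia.
Qed.

Definition supp F : {set 'I_n} := [set x | 0 < F x].

Lemma ex_supp_intersecting t c g :
  k.*2 <= n + t -> (forall x, 0 < c x) -> kfamily t c g ->
  exists g' : {set M}, [/\ #|g'| = #|g|, forall F, F \in g' -> msum F = k &
    forall F G, F \in g' -> G \in g' -> t <= #|supp F :&: supp G|].
Proof.
move=> le_kn; have [d] := ubnP (\sum_(x < n) c x).
elim: d c g => // d IH c g lt_d c0 fg.
have [/existsP[i ci1]|] := boolP [exists i, 1 < c i].
  have [h ch fh] := lower_kernel le_kn c0 ci1 fg.
  have [| |g' [cg' sg' tg']] := IH _ _ _ _ fh; last by exists g'; rewrite -ch.
    rewrite ltnS in lt_d; apply: leq_trans lt_d.
    rewrite (bigD1 i) //= [ltnRHS](bigD1 i) //= eqxx.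
    rewrite (eq_bigr c) => [|x /negbTE ->] //.
    by rewrite ltn_add2r ltn_predL ltnW.
  by move=> x; case: eqP => _ //; rewrite -subn1 subn_gt0.
rewrite negb_exists => /forallP c1; case: fg => sg tg.
exists g; split=> // F G Fg Gg; apply: leq_trans (tg _ _ Fg Gg) _.
rewrite -sum1_card big_mkcond; apply: leq_sum => x _; rewrite !inE.
by have := c1 x; have := c0 x; case: (F x) => [[|a] ?]; case: (G x) => [[|b] ?] /=; lia.
Qed.

End Kernel.

(** * Coding multisets by sets of the same size *)

Section Encoding.
Variables (n k : nat).
Local Notation M := {ffun 'I_n -> 'I_k.+2}.
Implicit Types F G : M.

Definition psum F (m : nat) := \sum_(x < n | x < m) F x.

(* [q : 'I_k] stands for the number [q.+1]; the size of the multisets is [k.+1]. *)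
Definition gaps F : {set 'I_k} :=
  [set q : 'I_k | [forall x, (x \in supp F) ==> (psum F x != q.+1)]].

Definition encode F : {set 'I_(n + k)} :=
  (@lshift n k @: supp F) :|: (@rshift n k @: gaps F).

Lemma psumS F (x : 'I_n) : psum F x.+1 = psum F x + F x.
Proof.
rewrite /psum (bigD1 x) //= addnC; congr (_ + _); apply: eq_bigl => y.
by rewrite ltnS andbC [RHS]ltn_neqAle.
Qed.

Lemma psum_mono F a b : a <= b -> psum F a <= psum F b.
Proof.
move=> le_ab; rewrite /psum [leqRHS](bigID (fun x : 'I_n => x < a)) /=.
suff -> : \sum_(x < n | (x < b) && (x < a)) F x = \sum_(x < n | x < a) F x.
  exact: leq_addr.
apply: eq_bigl => x; case: (ltnP x a) => [lt_x|_]; rewrite ?andbF // andbT.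
exact: leq_trans lt_x le_ab.
Qed.

Lemma psum_le F a : psum F a <= msum F.
Proof. by rewrite /msum [leqRHS](bigID (fun x : 'I_n => x < a)) leq_addr. Qed.

Lemma psum_next F a : psum F a < msum F ->
  exists2 x : 'I_n, x \in supp F & psum F x = psum F a.
Proof.
move=> lt_a.
have [x0 /andP[le0 s0]] : exists x : 'I_n, (a <= x) && (x \in supp F).
  apply/existsP; apply: contraLR lt_a; rewrite negb_exists => /forallP no.
  rewrite -leqNgt /psum /msum [leqLHS](bigID (fun x : 'I_n => x < a)) /=.
  rewrite [X in _ + X]big1 ?addn0 // => x; rewrite -leqNgt => le_a.
  by apply/eqP; rewrite -leqn0 leqNgt; have := no x; rewrite le_a inE.
pose P (x : 'I_n) := (a <= x) && (x \in supp F).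
have P0 : P x0 by rewrite /P le0.
case: (arg_minnP (fun x : 'I_n => val x) P0) => x /andP[le_x sx] minx.
exists x => //; rewrite /psum (bigID (fun y : 'I_n => y < a)) /=.
rewrite [X in _ + X]big1 ?addn0 => [|y /andP[lt_y]].
  apply: eq_bigl => y; rewrite andbC; case: (ltnP y a) => //= lt_y.
  exact: leq_trans le_x.
rewrite -leqNgt => le_y; apply/eqP; rewrite -leqn0 leqNgt; apply: contraL lt_y => Fy.
by rewrite -leqNgt; apply: minx; rewrite /P le_y inE.
Qed.

Lemma psum_lt F (x y : 'I_n) : x \in supp F -> x < y -> psum F x < psum F y.
Proof.
rewrite inE => Fx lt_xy; apply: leq_trans (psum_mono F lt_xy).
by rewrite psumS -addn1 leq_add2l.
Qed.

(** The partial sums at the support points are distinct numbers in [[0, k]], and 0 is one of them;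
    the gaps, lifted past 0, are exactly the remaining numbers. *)
Lemma card_gaps F : msum F = k.+1 -> #|gaps F| + #|supp F| = k.+1.
Proof.
move=> sF.
have lt_psum (x : 'I_n) : x \in supp F -> psum F x < k.+1.
  rewrite inE => Fx; rewrite -sF; apply: leq_trans (psum_le F x.+1).
  by rewrite psumS -addn1 leq_add2l.
pose st (x : 'I_n) : 'I_k.+1 := inord (psum F x).
have stE x : x \in supp F -> st x = psum F x :> nat.
  by move=> /lt_psum ?; rewrite inordK.
have inj_st : {in supp F &, injective st}.
  move=> x y xs ys /(congr1 val) /=; rewrite !stE // => e; apply: val_inj => /=.
  by have [/(psum_lt xs)|/(psum_lt ys)|//] := ltngtP x y; rewrite e ltnn.
rewrite -(card_in_imset inj_st) -(card_imset _ (@lift_inj _ ord0)).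
rewrite (_ : imset _ _ = ~: (st @: supp F)); first by rewrite addnC cardsC card_ord.
apply/setP => y; rewrite in_setC; apply/imsetP/idP => [[q qg ->]|].
  apply/imsetP => -[x xs /(congr1 val)] /=; rewrite stE // /bump /= => e.
  by move: qg; rewrite inE => /forall_inP/(_ x xs); rewrite -e add1n eqxx.
case: (unliftP ord0 y) => [q ->|->] ny.
  exists q => //; rewrite inE; apply/forall_inP => x xs; apply: contra ny => /eqP e.
  by apply/imsetP; exists x => //; apply: val_inj; rewrite /= stE // e.
case/negP: ny; have p0 : psum F 0 = 0 by rewrite /psum big_pred0.
have [|x xs e] := @psum_next F 0; first by rewrite p0 sF.
by apply/imsetP; exists x => //; apply: val_inj; rewrite /= stE // e p0.
Qed.

Lemma card_encode F : msum F = k.+1 -> #|encode F| = k.+1.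
Proof.
move=> sF.
have d0 : (@lshift n k @: supp F) :&: (@rshift n k @: gaps F) = set0.
  apply/setP => y; rewrite in_setI in_set0; apply/negP => /andP[/imsetP[a _ ->]].
  by case/imsetP => b _ /eqP; rewrite eq_lrshift.
rewrite cardsU d0 cards0 subn0 addnC (card_imset _ (@lshift_inj n k)).
by rewrite (card_imset _ (@rshift_inj n k)) card_gaps.
Qed.

Lemma lshift_encode F (x : 'I_n) : (lshift k x \in encode F) = (x \in supp F).
Proof.
rewrite in_setU (mem_imset _ _ (@lshift_inj n k)).
suff /negbTE -> : lshift k x \notin @rshift n k @: gaps F by rewrite orbF.
by apply/negP => /imsetP[b _ /eqP]; rewrite eq_lrshift.
Qed.

Lemma rshift_encode F (q : 'I_k) : (rshift n q \in encode F) = (q \in gaps F).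
Proof.
rewrite in_setU (mem_imset _ _ (@rshift_inj n k)).
suff /negbTE -> : rshift n q \notin @lshift n k @: supp F by [].
by apply/negP => /imsetP[b _ /eqP]; rewrite eq_rlshift.
Qed.

(** Let [x] be the first point with [F x != G x], say [F x < G x]. The supports agree, so [F x] is
    positive; [psum F x.+1] is then a partial sum of [F] at a support point, while the partial sums
    of [G] jump over it, and the gaps differ. *)
Lemma encode_inj : {in [pred F | msum F == k.+1] &, injective encode}.
Proof.
have absurd_lt F G (x : 'I_n) : msum F = k.+1 -> msum G = k.+1 -> encode F = encode G ->
    psum F x = psum G x -> F x < G x -> False.
  move=> sF sG eFG ep ltF.
  have xG : x \in supp G by rewrite inE; apply: leq_trans ltF.
  have xF : x \in supp F by rewrite -lshift_encode eFG lshift_encode.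
  have p0 : 0 < psum F x.+1.
    by move: xF; rewrite inE psumS => /leq_trans; apply; rewrite leq_addl.
  have lt_p : psum F x.+1 < psum G x.+1 by rewrite !psumS ep ltn_add2l.
  have le_p : psum F x.+1 < k.+1 by rewrite -sG; apply: leq_trans (psum_le G x.+1).
  have [|y yF ey] := @psum_next F x.+1; first by rewrite sF.
  have lt_q : (psum F x.+1).-1 < k by rewrite -ltnS prednK.
  have : Ordinal lt_q \notin gaps F.
    rewrite inE negb_forall; apply/existsP; exists y.
    by rewrite yF /= prednK // ey eqxx.
  rewrite -rshift_encode eFG rshift_encode inE negb_forall => /existsP[z].
  rewrite negb_imply negbK /= prednK // => /andP[zG /eqP ez].
  have [le_zx|lt_xz] := leqP z x.
    have := psum_mono G le_zx.
    rewrite ez -ep psumS -[X in _ <= X]addn0 leq_add2l leqNgt.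
    by move: xF; rewrite inE => ->.
  by have := psum_mono G lt_xz; rewrite ez leqNgt lt_p.
move=> F G /eqP sF /eqP sG eFG; apply/ffunP => x; apply: val_inj => /=.
have [m] := ubnP (val x); elim: m x => // m IH x lt_m.
have ep : psum F x = psum G x.
  by apply: eq_bigr => y lt_y; apply: IH; apply: leq_trans lt_y _.
have [lt|lt|//] := ltngtP (F x) (G x).
  by case: (absurd_lt F G x).
by case: (absurd_lt G F x).
Qed.

Lemma encode_cap F G : #|supp F :&: supp G| <= #|encode F :&: encode G|.
Proof.
rewrite -(card_imset _ (@lshift_inj n k)); apply/subset_leq_card/subsetP.
by move=> _ /imsetP[x /setIP[xF xG] ->]; rewrite in_setI !lshift_encode xF.
Qed.

End Encoding.

(** * The bound for multisets *)

Lemma card_AK_multiset n k t (g : {set {ffun 'I_n -> 'I_k.+1}}) :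
  0 < t -> t <= k -> 2 * k - t <= n ->
  (forall F, F \in g -> msum F = k) ->
  (forall F G, F \in g -> G \in g -> t <= \sum_(x < n) minn (F x) (G x)) ->
  #|g| <= AK (n + k - 1) k t.
Proof.
case: k g => [|k] g t0 le_tk le_n sg tg; first by move: (leq_trans t0 le_tk).
have -> : n + k.+1 - 1 = n + k by rewrite addnS subn1.
(* Thresholds equal to the cardinality [k.+1] truncate nothing. *)
have [||g' [<- sg' tg']] := @ex_supp_intersecting n k.+1 t (fun=> k.+1) g _ (fun=> isT).
- by clear -le_n; lia.
- split=> // F G Fg Gg; apply: leq_trans (tg _ _ Fg Gg) _; apply: leq_sum => x _.
  by rewrite [X in _ <= X](minn_idPl _) // geq_min leq_ord.
rewrite -(card_in_imset (f := @encode n k)); last first.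
  by move=> F G Fg Gg; apply: encode_inj; rewrite inE sg'.
have tE : tfamily k.+1 t (@encode n k @: g').
  apply/tfamilyP; split=> [_ /imsetP[F Fg ->]|_ _ /imsetP[F Fg ->] /imsetP[G Gg ->]].
    by rewrite card_encode // sg'.
  exact: leq_trans (tg' _ _ Fg Gg) (encode_cap F G).
have [le_kt|lt_tk] := leqP k.+1 t.
  apply: leq_trans (tfamily_full le_kt tE) (leq_trans _ (leq_AK _ _ _ 0)).
  by rewrite A_fam_gt0 // le_tk; clear -le_n le_tk; lia.
have [big|small] := leqP (k.+1.*2.+2) (n + k + t); first exact: complete_intersection.
(* Here [n + k + t] is at least [3 * k.+1 - 1], so only [k.+1 = 2] and [t = 1] remain. *)
have [t1 eN] : t = 1 /\ n + k = k.+1.*2 by clear -small le_n t0 lt_tk; lia.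
move: tE; move: (@encode n k @: g'); rewrite {}eN t1 => f; exact: intersecting_half.
Qed.

Local Open Scope fset_scope.
Local Open Scope mset_scope.
Local Open Scope nat_scope.

Theorem theorem1p8 (n k t : nat) (FF : {fset {mset 'I_n}}) :
  0 < n -> 0 < k -> 1 <= t -> t <= k -> 2 * k - t <= n ->
  in_M k t FF ->
  #|` FF| <= AK (n + k - 1) k t.
Proof.
move=> _ _ t0 le_tk le_n [sF tF].
(* Multiplicities are at most the cardinality [k], so on [FF] the default value of [inord] never
   occurs. *)
pose conv (F : {mset 'I_n}) : {ffun 'I_n -> 'I_k.+1} := [ffun x => inord (F x)].
have convE F x : F \in FF -> conv F x = F x :> nat.
  move=> FFF; rewrite ffunE inordK // ltnS -[leqRHS](sF F FFF) /mcard.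
  by rewrite (bigD1 x) //= leq_addr.
have inj_conv : injective (fun F : FF => conv (val F)).
  move=> F G e; apply: val_inj; apply/msetP => x.
  by rewrite -!convE ?(valP F) ?(valP G) // e.
rewrite cardfE -(card_imset _ inj_conv); apply: card_AK_multiset => //.
  move=> _ /imsetP[F _ ->]; rewrite -[RHS](sF _ (valP F)).
  by apply: eq_bigr => x _; rewrite convE ?(valP F).
move=> _ _ /imsetP[F _ ->] /imsetP[G _ ->].
apply: leq_trans (tF _ _ (valP F) (valP G)) _.
by apply: leq_sum => x _; rewrite msetE2 !convE ?(valP F) ?(valP G).
Qed.
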